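(* The dual space $\big(\mathcal A^1_1\big)^*$ is not contained in $\mathcal X(\mathcal A^2_1)$; that is, there exists a Dirichlet series $g\in(\mathcal A^1_1)^*$ for which the Volterra operator $T_g$ is not bounded on $\mathcal A^2_1$.
   Context: $d(n)$ denotes the number of divisors of $n$. $\mathcal A^2_1$ is the Hilbert space of Dirichlet series $f(s)=\sum_{n\ge1}a_nn^{-s}$ with $\|f\|^2_{\mathcal A^2_1}=\sum_{n\ge1}|a_n|^2/d(n)<\infty$ and inner product $\langle\sum a_nn^{-s},\sum b_nn^{-s}\rangle_{\mathcal A^2_1}=\sum_na_n\overline{b_n}/d(n)$. Bohr lift: for $n=p_1^{\kappa_1}p_2^{\kappa_2}\cdots$ ($p_j$ the $j$-th prime) let $\kappa(n)=(\kappa_1,\kappa_2,\dots)$; for $f=\sum a_nn^{-s}$, $\mathcal Bf(\chi)=\sum_na_n\chi^{\kappa(n)}$. Let $V$ be Lebesgue area measure on the unit disk $\mathbb D$ normalized by $V(\mathbb D)=1$, and $\mu=V\times V\times\cdots$ on $\mathbb D^\infty$. $\mathcal A^1_1$ is the completion of the space $\mathcal P$ of Dirichlet polynomials in the norm $\|f\|_{\mathcal A^1_1}=\int_{\mathbb D^\infty}|\mathcal Bf|\,d\mu$. A Dirichlet series $\phi$ is in $(\mathcal A^1_1)^*$ if the functional $f\mapsto\langle f,\phi\rangle_{\mathcal A^2_1}$, $f\in\mathcal P$, extends to a bounded functional on $\mathcal A^1_1$. Volterra operator: $T_gf(s)=-\int_s^{+\infty}f(u)g'(u)\,du$, $\Re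 s>1/2$; in terms of coefficients, if $f=\sum a_nn^{-s}$ and $g=\sum b_nn^{-s}$, then $T_gf(s)=\sum_{n\ge2}\frac1{\log n}\big(\sum_{k\mid n,\,k<n}a_k b_{n/k}\log(n/k)\big)n^{-s}$. $\mathcal X(\mathcal A^2_1)$ is the set of Dirichlet series $g$ (convergent in some half-plane) for which $T_g$ is bounded on $\mathcal A^2_1$. *)

(* Defs.v *)
(* Bergman spaces A^2_1 and A^1_1 of Dirichlet series, over MathComp-Analysis.

   A Dirichlet series sum_(n >= 1) b_n n^(-s) is its coefficient function
   b : nat -> R[i]; the value b 0 is never used.  A Dirichlet polynomial is
   f : {poly R[i]} with the index shifted by one: f`_m is the coefficient of
   (m + 1)^(-s), so that {poly R[i]} is exactly the space of Dirichlet
   polynomials.  Only its module structure is used. *)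
From HB Require Import structures.
From mathcomp Require Import all_boot all_order all_algebra.
From mathcomp Require Import complex.
From mathcomp Require Import all_classical all_reals all_analysis.
From mathcomp Require Import measurable_realfun.
From mathcomp Require Import ring lra.

Set Implicit Arguments.
Unset Strict Implicit.
Unset Printing Implicit Defensive.
Import Order.TTheory GRing.Theory Num.Theory.
Import numFieldNormedType.Exports.

Local Open Scope classical_set_scope.
Local Open Scope ring_scope.

Definition seq_cylinders d (T : measurableType d) : set (set (nat -> T)) :=
  [set A | exists i B, measurable B /\ A = [set x | B (x i)]].

Notation seqspace T := (g_sigma_algebraType (@seq_cylinders _ T)).

Section infinite_product.
Local Open Scope ereal_scope.
Context d (T : measurableType d) (R : realType) (P : probability T R).

Local Notation S := (seqspace T).
Implicit Types (F G : S -> \bar R) (A B : set S) (x y : S) (j k m n : nat).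

Let upd (x : S) (k : nat) (t : T) : S := fun i => if i == k then t else x i.

Let measurable_coord i : measurable_fun [set: S] (fun x : S => x i).
Proof.
move=> _ B mB; rewrite setTI; apply: sub_sigma_algebra.
by exists i, B.
Qed.

Let measurable_toseq d' (U : measurableType d') (f : U -> S) :
  (forall i, measurable_fun [set: U] (fun u => f u i)) ->
  measurable_fun [set: U] f.
Proof.
move=> mf; apply: (@measurability _ _ U S setT f (@seq_cylinders _ T) erefl).
move=> _ [_ [i [B [mB ->]]] <-].
exact: mf.
Qed.

Let measurable_upd k :
  measurable_fun [set: S * T] (fun z : S * T => upd z.1 k z.2).
Proof.
apply: measurable_toseq => i; rewrite /upd; case: (i == k).
  exact: measurable_snd.
exact: (measurableT_comp (measurable_coord i) measurable_fst).
Qed.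

Let measurable_updr k (x : S) : measurable_fun [set: T] (upd x k).
Proof.
apply: measurable_toseq => i; rewrite /upd; case: (i == k).
  exact: measurable_id.
exact: measurable_cst.
Qed.

(* The coordinates k, ..., k + j - 1 are integrated out. *)
Fixpoint iter_int (j k : nat) (F : S -> \bar R) : S -> \bar R :=
  if j is j'.+1 then fun x => \int[P]_t iter_int j' k.+1 F (upd x k t) else F.

Let iter_int_ge0 j k F : (forall x, 0 <= F x) -> forall x, 0 <= iter_int j k F x.
Proof.
move=> F0; elim: j k => [|j ih] k x //=; apply: integral_ge0 => t _; exact: ih.
Qed.

Let measurable_iter_int j k F : (forall x, 0 <= F x) ->
  measurable_fun [set: S] F -> measurable_fun [set: S] (iter_int j k F).
Proof.
move=> F0 mF; elim: j k => [|j ih] k //=.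
apply: (@measurable_fun_fubini_tonelli_F _ _ S T R P
  (fun z => iter_int j k.+1 F (upd z.1 k z.2))).
  exact: (measurableT_comp (ih _) (measurable_upd k)).
by move=> z; exact: iter_int_ge0.
Qed.

Let measurable_iter_upd j k l x F : (forall x, 0 <= F x) ->
  measurable_fun [set: S] F ->
  measurable_fun [set: T] (fun t => iter_int j k F (upd x l t)).
Proof.
move=> F0 mF.
exact: (measurableT_comp (measurable_iter_int _ _ F0 mF) (measurable_updr _ _)).
Qed.

Let iter_intD j k F G x : (forall x, 0 <= F x) -> (forall x, 0 <= G x) ->
  measurable_fun [set: S] F -> measurable_fun [set: S] G ->
  iter_int j k (fun x => F x + G x) x = iter_int j k F x + iter_int j k G x.
Proof.
move=> F0 G0 mF mG; elim: j k x => [|j ih] k x //=.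
rewrite -ge0_integralD//.
- by apply: eq_integral => t _; exact: ih.
- by move=> t _; exact: iter_int_ge0.
- exact: measurable_iter_upd.
- by move=> t _; exact: iter_int_ge0.
- exact: measurable_iter_upd.
Qed.

Let le_iter_int j k F G x : (forall x, 0 <= F x) -> (forall x, F x <= G x) ->
  measurable_fun [set: S] F -> measurable_fun [set: S] G ->
  iter_int j k F x <= iter_int j k G x.
Proof.
move=> F0 FG mF mG; have G0 y : 0 <= G y by exact: le_trans (FG y).
elim: j k x => [|j ih] k x //=; apply: ge0_le_integral => //.
- by move=> t _; exact: iter_int_ge0.
- exact: measurable_iter_upd.
- exact: measurable_iter_upd.
Qed.

Let integral_cstP (c : \bar R) : \int[P]_t c = c.
Proof. by rewrite integral_cst// [X in _ * X](@probability_setT _ _ _ P) mule1. Qed.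

Let iter_int_cst j k (c : \bar R) x : iter_int j k (fun=> c) x = c.
Proof.
elim: j k x => [|j ih] k x //=.
by rewrite (eq_integral (cst c)) ?integral_cstP// => t _; exact: ih.
Qed.

Let depends n (F : S -> \bar R) :=
  forall x y, (forall i, (i < n)%N -> x i = y i) -> F x = F y.

Let depends_le m n F : (m <= n)%N -> depends m F -> depends n F.
Proof.
move=> mn dF x y xy; apply: dF => i im; apply: xy; exact: leq_trans mn.
Qed.

Let depends_iter_int j k F : depends (k + j) F -> depends k (iter_int j k F).
Proof.
elim: j k => [|j ih] k dF x y xy /=; first by apply: dF; rewrite addn0.
apply: eq_integral => t _; apply: (ih k.+1); first by rewrite addSnnS.
move=> i; rewrite /upd ltnS leq_eqVlt; case: eqP => //= _; exact: xy.
Qed.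

Let iter_int_stable j k F x : depends (k + j) F ->
  iter_int j.+1 k F x = iter_int j k F x.
Proof.
elim: j k x => [|j ih] k x dF.
  rewrite /=; under eq_integral.
    move=> t _; rewrite (dF _ x); first over.
    by rewrite addn0 => i ik; rewrite /upd (ltn_eqF ik).
  exact: integral_cstP.
by apply: eq_integral => t _; apply: ih; rewrite addSnnS.
Qed.

Let iter_int_le m n F x : depends m F -> (m <= n)%N ->
  iter_int n 0 F x = iter_int m 0 F x.
Proof.
move=> dF /subnK <-; elim: (n - m)%N => [//|k ih]; rewrite -ih addSn.
by apply: iter_int_stable; apply: depends_le dF; rewrite leq_addl.
Qed.

Let ind (A : set S) : S -> \bar R := fun x => (\1_A x)%:E.

Let ind_ge0 A x : 0 <= ind A x. Proof. by rewrite lee_fin. Qed.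

Let ind_le1 A x : ind A x <= 1.
Proof. by rewrite lee_fin indicE; case: (_ \in _). Qed.

Let measurable_ind A : measurable A -> measurable_fun [set: S] (ind A).
Proof. by move=> mA; apply/measurable_EFinP; exact: measurable_indic. Qed.

Let cyl (A : set S) := measurable A /\ exists n, depends n (ind A).

Let cyl0 : cyl set0.
Proof. by split=> //; exists 0%N => x y _; rewrite /ind !indic0. Qed.

Let indU_dep n A B : depends n (ind A) -> depends n (ind B) ->
  depends n (ind (A `|` B)).
Proof.
move=> dA dB x y xy; have := dA _ _ xy; have := dB _ _ xy.
rewrite /ind !indicE !in_setU.
by case: (x \in A); case: (y \in A); case: (x \in B); case: (y \in B) => //= -[].
Qed.

Let cylU : setU_closed cyl.
Proof.
move=> A B [mA [m dA]] [mB [n dB]]; split; first exact: measurableU.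
exists (maxn m n); apply: indU_dep.
  exact: depends_le (leq_maxl _ _) dA.
exact: depends_le (leq_maxr _ _) dB.
Qed.

Let cylC : setC_closed cyl.
Proof.
move=> A [mA [m dA]]; split; first exact: measurableC.
exists m => x y xy; have := dA _ _ xy.
rewrite /ind !indicE !in_setC.
case: (x \in A); case: (y \in A) => //= -[] /eqP;
  by rewrite ?oner_eq0 1?eq_sym ?oner_eq0.
Qed.

(* A copy of the sequence space carrying the algebra of measurable sets that
   depend on finitely many coordinates. *)
Definition cylspace := nat -> T.
HB.instance Definition _ := Pointed.on cylspace.
HB.instance Definition _ := @isAlgebraOfSets.Build d cylspace cyl cyl0 cylU cylC.

Let dim (A : set S) : nat := xget 0%N [set n | depends n (ind A)].

Definition cyl_content (A : set cylspace) : \bar R :=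
  iter_int (dim A) 0 (ind A) point.

Let cyl_contentE n A : depends n (ind A) ->
  cyl_content A = iter_int n 0 (ind A) point.
Proof.
move=> dA; rewrite /cyl_content; have dd : depends (dim A) (ind A).
  exact: (@xgetI _ 0%N [set n | depends n (ind A)] n dA).
have [nd|/ltnW nd] := leqP (dim A) n; last exact: iter_int_le.
by rewrite (@iter_int_le (dim A) n).
Qed.

Let cyl_content0 : cyl_content set0 = 0.
Proof.
rewrite /cyl_content (_ : ind set0 = fun=> 0) ?iter_int_cst//.
by apply/funext => x; rewrite /ind indic0.
Qed.

Let cyl_content_ge0 A : 0 <= cyl_content A.
Proof. exact: iter_int_ge0. Qed.

Let cyl_contentT : cyl_content setT = 1.
Proof.
rewrite /cyl_content (_ : ind setT = fun=> 1) ?iter_int_cst//.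
by apply/funext => x; rewrite /ind indicT.
Qed.

Let cyl_content_additive2 : additive2 cyl_content.
Proof.
move=> A B [mA [m dA]] [mB [n dB]] AB0.
have dA' := depends_le (leq_maxl m n) dA.
have dB' := depends_le (leq_maxr m n) dB.
rewrite (cyl_contentE (indU_dep dA' dB')) (cyl_contentE dA') (cyl_contentE dB').
rewrite -iter_intD//; [|exact: measurable_ind..].
congr (iter_int _ _ _ _); apply/funext => x.
rewrite /ind !indicE in_setU -EFinD.
have [xA|_] := boolP (x \in A); last by rewrite add0r.
have [xB|_] := boolP (x \in B); last by rewrite addr0.
have : (A `&` B) x by split; exact: set_mem.
by rewrite AB0.
Qed.

Let cyl_content_semi_additive : measure_function.semi_additive cyl_content.
Proof. exact/(additive2P cyl_content0). Qed.

HB.instance Definition _ := @isContent.Build d cylspace R cyl_content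
  cyl_content_ge0 cyl_content_semi_additive.


Let depends_iter_id j k F x : depends k F -> iter_int j k F x = F x.
Proof.
move=> dF; elim: j => [//|j <-]; apply: iter_int_stable.
exact: depends_le (leq_addr _ _) dF.
Qed.

(* Continuity at the empty set, by choosing the coordinates of a point of the
   intersection one after the other. *)
Let cyl_content_cvg0 (A : (set S)^nat) : (forall m, cyl (A m)) ->
  (forall m n, (m <= n)%N -> A n `<=` A m) -> \bigcap_m A m = set0 ->
  cyl_content (A m) @[m --> \oo] --> 0.
Proof.
move=> cA ndA A0.
have mA m : measurable (A m) := (cA m).1.
have [dm dA] : {dm : nat -> nat | forall m, depends (dm m) (ind (A m))}.
  by exists (fun m => sval (cid (cA m).2)) => m; exact: svalP (cid (cA m).2).
pose h k m x := iter_int (dm m - k) k (ind (A m)) x.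
have hE k m x : h k m x = \int[P]_t h k.+1 m (upd x k t).
  rewrite /h; have [km|mk] := ltnP k (dm m); first by rewrite -(subnSK km).
  rewrite (eqP mk) (_ : (dm m - k.+1)%N = 0%N); last exact/eqP/leqW.
  rewrite /=; under eq_integral.
    move=> t _; rewrite (dA m _ x); first over.
    by move=> i im; rewrite /upd ltn_eqF// (leq_trans im).
  by rewrite integral_cstP.
pose conv k x := h k m x @[m --> \oo] --> 0.
have step k x : ~ conv k x -> exists t, ~ conv k.+1 (upd x k t).
  move=> ncv; apply: contrapT => /forallNP cv; apply: ncv.
  rewrite /conv; under eq_fun do rewrite hE.
  suff : \int[P]_t h k.+1 m (upd x k t) @[m --> \oo] --> \int[P]_t cst 0 t.
    by rewrite integral_cstP.
  apply: (@dominated_cvg _ _ _ P setT measurableT _ (cst 0) (cst 1)).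
  - by move=> m; apply: measurable_iter_upd => //; exact: measurable_ind.
  - by move=> t _; exact: contrapT (cv t).
  - by [].
  - exact: finite_measure_integrable_cst.
  - move=> m t _; rewrite gee0_abs; last exact: iter_int_ge0.
    rewrite -[leRHS](@iter_int_cst (dm m - k.+1) k.+1 1 (upd x k t)).
    by apply: le_iter_int => //; exact: measurable_ind.
apply: contrapT => nc0.
have nconv0 : ~ conv 0%N point.
  move=> c0; apply: nc0; rewrite /conv /h in c0.
  by under eq_fun do rewrite (cyl_contentE (dA _)) -{1}(subn0 (dm _)).
have nxt k (y : {x | ~ conv k x}) : {t | ~ conv k.+1 (upd (sval y) k t)}.
  exact: cid (step _ _ (svalP y)).
pose fix xs k : {x | ~ conv k x} :=
  if k is k'.+1 then
    exist (fun x => ~ conv k'.+1 x) (upd (sval (xs k')) k' (sval (nxt k' (xs k'))))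
      (svalP (nxt k' (xs k')))
  else exist (fun x => ~ conv 0%N x) _ nconv0.
pose y : S := fun i => sval (xs i.+1) i.
have xsy k i : (i < k)%N -> sval (xs k) i = y i.
  elim: k => [//|k ih]; rewrite ltnS leq_eqVlt => /predU1P[->//|ik].
  by rewrite -ih//= /upd ltn_eqF.
have ny k : ~ conv k y.
  have := svalP (xs k); rewrite /conv => nx cy; apply: nx.
  under eq_fun => m.
    rewrite /h (@depends_iter_int _ _ _ _ (sval (xs k)) y)//; first over.
      by apply: depends_le (dA m); rewrite -leq_subLR.
    exact: xsy.
  exact: cy.
have Ay m0 : A m0 y.
  apply: contrapT => nAy; apply: (ny (dm m0)).
  apply: cvg_near_cst; exists m0 => // m /= m0m.
  apply/eqP; rewrite eq_le iter_int_ge0// andbT.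
  have /le_trans -> // : h (dm m0) m y <=
      iter_int (dm m - dm m0) (dm m0) (ind (A m0)) y.
    apply: le_iter_int => //; [|exact: measurable_ind..].
    move=> x; rewrite lee_fin !indicE; have [xm|//] := boolP (x \in A m).
    by rewrite mem_set//; apply: (ndA _ _ m0m); exact: set_mem.
  by rewrite depends_iter_id// /ind indicE memNset.
suff : (\bigcap_m A m) y by rewrite A0.
by move=> m _; exact: Ay.
Qed.

Let cyl_content_fin A : cyl A -> cyl_content A \is a fin_num.
Proof.
move=> [mA _]; rewrite ge0_fin_numE ?cyl_content_ge0//.
apply: (@le_lt_trans _ _ 1); last by rewrite ltry.
rewrite -[leRHS](@iter_int_cst (dim A) 0%N 1 point).
by apply: le_iter_int => //; exact: measurable_ind.
Qed.

Let cyl_content_semi_sigma_additive : semi_sigma_additive cyl_content.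
Proof.
move=> F mF tF mUF.
pose B n : set cylspace := (\bigcup_i F i) `\` \big[setU/set0]_(i < n) F i.
have mb n : measurable (\big[setU/set0]_(i < n) F i : set cylspace).
  exact: bigsetU_measurable.
have mB n : measurable (B n : set cylspace) by exact: measurableD.
have B0 : cyl_content (B n) @[n --> \oo] --> 0.
  apply: cyl_content_cvg0 => //.
    by move=> m n mn; apply: setDS; exact: subset_bigsetU.
  apply/seteqP; split=> // x Bx; have [[i _ Fix] _] := Bx 0%N I.
  have [_] := Bx i.+1 I; apply.
  by rewrite big_ord_recr; right.
have E : (fun n => \sum_(0 <= i < n) cyl_content (F i)) =
    (fun n => cyl_content (\bigcup_n F n) - cyl_content (B n)).
  apply/funext => n; rewrite big_mkord -cyl_content_semi_additive//.
  have -> : \bigcup_n F n = \big[setU/set0]_(i < n) F i `|` B n.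
    by rewrite /B setDUK//; exact: bigsetU_bigcup.
  rewrite cyl_content_additive2//; last by rewrite /B setDIK.
  by rewrite addeK//; exact: cyl_content_fin (mB n).
rewrite E -[X in _ --> X]sube0; apply: cvgeB => //.
  by rewrite fin_num_adde_defl.
exact: cvg_cst.
Qed.

HB.instance Definition _ := @Content_isMeasure.Build d cylspace R cyl_content
  cyl_content_semi_sigma_additive.

Let rect n (B : nat -> set T) : set S :=
  [set x | forall i, (i < n)%N -> B i (x i)].

Let measurable_rect n (B : nat -> set T) :
  (forall i, measurable (B i)) -> measurable (rect n B).
Proof.
move=> mB; have -> : rect n B = \bigcap_i [set x : S | (i < n)%N -> B i (x i)].
  by apply/seteqP; split => x Bx i => [_|]; [exact: Bx|exact: Bx i I].
apply: bigcapT_measurable => i; apply: sub_sigma_algebra.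
exists i, [set t | (i < n)%N -> B i t]; split=> //.
have [_|_] := boolP (i < n)%N.
  rewrite (_ : [set t | _] = B i)//; apply/seteqP.
  by split=> t /= => [/(_ isT)|].
by rewrite (_ : [set t | _] = setT)//; apply/seteqP; split.
Qed.

Let depends_rect n (B : nat -> set T) : depends n (ind (rect n B)).
Proof.
move=> x y xy; rewrite /ind !indicE; congr ((nat_of_bool _)%:R%:E).
apply/idP/idP; rewrite !inE => + i ni => /(_ i ni); first by rewrite xy.
by rewrite -xy.
Qed.

Let ind_rectS k (B : nat -> set T) x t :
  ind (rect k.+1 B) (upd x k t) = ind (rect k B) x * (\1_(B k) t)%:E.
Proof.
rewrite /ind !indicE -EFinM -natrM mulnb; congr ((nat_of_bool _)%:R%:E).
apply/idP/andP.
  rewrite !inE => Bx; split.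
    by move=> i ik; have := Bx i (leqW ik); rewrite /upd ltn_eqF.
  by have := Bx k (ltnSn k); rewrite /upd eqxx.
rewrite !inE => -[Bx Bt] i; rewrite ltnS leq_eqVlt /upd.
by case: eqP => [->|_ /=]; [|exact: Bx].
Qed.

Let iter_int_rect j k (B : nat -> set T) x : (forall i, measurable (B i)) ->
  iter_int j k (ind (rect (k + j) B)) x =
  ind (rect k B) x * \prod_(k <= i < k + j) P (B i).
Proof.
move=> mB; elim: j k x => [|j ih] k x.
  by rewrite /= addn0 big_geq// mule1.
rewrite big_ltn; last by rewrite addnS ltnS leq_addr.
rewrite /= -addSnnS; under eq_integral do rewrite ih ind_rectS.
set c := \big[_/_]_(_ <= _ < _) _.
have c0 : 0 <= c by apply: (big_ind (fun z : \bar R => 0 <= z)) => // *; exact: mule_ge0.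
have mI : measurable_fun [set: T] (fun t => (\1_(B k) t)%:E : \bar R).
  by apply/measurable_EFinP; exact: measurable_indic.
under eq_integral do rewrite -muleA (muleC (\1_(B k) _)%:E) muleA.
rewrite ge0_integralZl//; last by rewrite mule_ge0.
by rewrite integral_indic// setIT -muleA (muleC c).
Qed.

Lemma infprod_exists : exists mu : probability S R,
  forall n (B : nat -> set T), (forall i, measurable (B i)) ->
    mu [set x | forall i, (i < n)%N -> B i (x i)] =
    \prod_(i < n) P (B i).
Proof.
pose nu : {measure set cylspace -> \bar R} := cyl_content.
pose mu0 : set S -> \bar R := measure_extension nu.
have sub A : measurable A ->
    measurable (A : set (g_sigma_algebraType (@measurable _ cylspace))).
  apply: smallest_sub; first exact: smallest_sigma_algebra.
  move=> _ [i [B [mB ->]]]; apply: sub_sigma_algebra; split.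
    by apply: sub_sigma_algebra; exists i, B.
  exists i.+1 => x y xy; rewrite /ind !indicE; congr ((nat_of_bool _)%:R%:E).
  by apply/idP/idP; rewrite !inE/= xy.
have mu00 : mu0 set0 = 0 by exact: (measure0 (measure_extension nu)).
have mu0_ge0 A : 0 <= mu0 A by exact: (measure_ge0 (measure_extension nu)).
have mu0s : semi_sigma_additive mu0.
  move=> F mF tF mUF.
  apply: (@measure_semi_sigma_additive _ _ _ (measure_extension nu)) => //.
    by move=> i; exact: sub.
  exact: sub.
pose mu1 := isMeasure.Build _ _ _ mu0 mu00 mu0_ge0 mu0s.
pose mu2 : {measure set S -> \bar R} := HB.pack mu0 mu1.
have mu0E A : cyl A -> mu0 A = cyl_content A.
  by move=> cA; exact: (@measurable_mu_extE _ _ _ nu).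
have mu0T : mu0 setT = 1.
  rewrite mu0E; first exact: cyl_contentT.
  by split=> //; exists 0%N => x y _; rewrite /ind !indicT.
pose mu3 := Measure_isProbability.Build _ _ _ mu2 mu0T.
pose mu : probability S R := HB.pack mu0 mu1 mu3.
exists mu => n B mB; rewrite [LHS](_ : _ = mu0 (rect n B))//.
rewrite mu0E; last first.
  by split; [exact: measurable_rect|exists n; exact: depends_rect].
rewrite (cyl_contentE (@depends_rect n B)) (@iter_int_rect n 0%N)//.
rewrite /ind indicE mem_set ?mul1e ?add0n ?big_mkord//.
Qed.

(* The product measure P x P x ... on sequences; the rectangles in [infprodE]
   form a pi-system generating the sigma-algebra, so it is unique. *)
Definition infprod : probability S R := sval (cid infprod_exists).

Lemma infprodE n (B : nat -> set T) : (forall i, measurable (B i)) ->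
  infprod [set x | forall i, (i < n)%N -> B i (x i)] =
  \prod_(i < n) P (B i).
Proof. exact: (svalP (cid infprod_exists)). Qed.

End infinite_product.
Section primes.
Local Open Scope nat_scope.

Lemma prime_gtn (m : nat) : exists p, (m < p) && prime p.
Proof. by have [p mp pp] := prime_above m; exists p; rewrite mp pp. Qed.

(* Numbered from 0: 2, 3, 5, ... *)
Fixpoint nth_prime (j : nat) : nat :=
  if j is i.+1 then ex_minn (prime_gtn (nth_prime i)) else 2.

Lemma prime_nth_prime j : prime (nth_prime j).
Proof. by case: j => //= j; case: ex_minnP => p /andP[]. Qed.

Lemma ltn_nth_prime j : j < nth_prime j.
Proof.
elim: j => //= j ih; case: ex_minnP => p /andP[jp _] _.
exact: leq_ltn_trans jp.
Qed.

Lemma nth_prime_surj p : prime p -> exists j, nth_prime j = p.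
Proof.
move=> pp; have [//|np] := pselect (exists j, nth_prime j = p).
suff /(_ p) : forall j, nth_prime j < p.
  by move=> /(ltn_trans (ltn_nth_prime p)); rewrite ltnn.
elim=> [|j ih].
  rewrite ltn_neqAle prime_gt1// andbT; apply/eqP => p2.
  by apply: np; exists 0.
rewrite ltn_neqAle; apply/andP; split.
  by apply/eqP => jp; apply: np; exists j.+1.
by rewrite /=; case: ex_minnP => q _; apply; rewrite ih pp.
Qed.

Definition kappa (n j : nat) : nat := logn (nth_prime j) n.

Definition numdiv (n : nat) : nat := size (divisors n).

End primes.

Section disk.
Context {R : realType}.

Definition unit_disk : set (measurableTypeR R * measurableTypeR R) :=
  [set z | z.1 ^+ 2 + z.2 ^+ 2 < 1].

Lemma measurable_unit_disk : measurable unit_disk.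
Proof.
rewrite [X in measurable X](_ : _ =
  (fun z : measurableTypeR R * measurableTypeR R => z.1 ^+ 2 + z.2 ^+ 2 : R)
    @^-1` `]-oo, 1[%classic).
  rewrite -[X in measurable X]setTI.
  apply: (_ : measurable_fun setT _) => //.
  apply: measurable_funD; apply: measurable_funX.
    exact: measurable_fst.
  exact: measurable_snd.
by apply/seteqP; split => z; rewrite /unit_disk /= in_itv.
Qed.

Definition planar_measure := (@lebesgue_measure R \x @lebesgue_measure R)%E.

Lemma planar_measure_disk : (0 < planar_measure unit_disk < +oo)%E.
Proof.
have box a b : (a < b)%R -> planar_measure (`[a, b] `*` `[a, b]) =
    ((b - a) * (b - a))%:E.
  move=> ab; rewrite /planar_measure product_measure1E//.
  have E : lebesgue_measure (`[a, b]%classic : set R) = (b - a)%:E.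
    by rewrite lebesgue_measure_itv/= lte_fin ab.
  by rewrite EFinM; exact: (congr2 mule E E).
apply/andP; split.
  apply: (@lt_le_trans _ _ (planar_measure (`[0, 2^-1] `*` `[0, 2^-1]))).
    by rewrite box ?invr_gt0// lte_fin subr0 mulr_gt0 ?invr_gt0.
  apply: le_measure; rewrite ?inE.
  - exact: measurableX.
  - exact: measurable_unit_disk.
  move=> -[x y] [] /=; rewrite !in_itv/= => /andP[x0 x1] /andP[y0 y1].
  by rewrite /unit_disk /=; nra.
apply: (@le_lt_trans _ _ (planar_measure (`[-1, 1] `*` `[-1, 1]))).
  apply: le_measure; rewrite ?inE.
  - exact: measurable_unit_disk.
  - exact: measurableX.
  move=> -[x y]; rewrite /unit_disk /= => xy.
  by split; rewrite /= in_itv/=; apply/andP; split; nra.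
by rewrite box ?ltry//; lra.
Qed.

(* Area normalized to total mass 1; by [planar_measure_disk] the default
   measure of [mnormalize] is not used.  It lives on the whole plane and
   vanishes outside the disk. *)
Definition disk_measure :
    probability (measurableTypeR R * measurableTypeR R)%type R :=
  mnormalize (mrestr planar_measure measurable_unit_disk) (\d_ point).

End disk.

Section bergman.
Context {R : realType}.

Definition polydisk : set (seqspace (measurableTypeR R * measurableTypeR R)%type) :=
  [set chi | forall j, unit_disk (chi j)].

Definition polydisk_measure :
    probability (seqspace (measurableTypeR R * measurableTypeR R)%type) R :=
  infprod disk_measure.

(* chi^kappa(n); by [ltn_nth_prime] the exponents kappa n j with n <= j
   vanish. *)
Definition bohr_monomial (n : nat) (chi : nat -> R * R) : R[i] :=
  \prod_(j < n) ((chi j).1 +i* (chi j).2)%C ^+ kappa n j.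

Definition bohr_lift (f : {poly R[i]}) (chi : nat -> R * R) : R[i] :=
  \sum_(m < size f) f`_m * bohr_monomial m.+1 chi.

Definition A11_norm (f : {poly R[i]}) : R :=
  \int[polydisk_measure]_(chi in polydisk) Normc.normc (bohr_lift f chi).

(* <f, b> in A^2_1 *)
Definition A21_pairing (f : {poly R[i]}) (b : nat -> R[i]) : R[i] :=
  \sum_(m < size f) f`_m * (b m.+1)^*%C / (numdiv m.+1)%:R.

(* The completion A^1_1 is represented by Cauchy sequences of Dirichlet
   polynomials, modulo sequences of norm 0; polynomials are the constant
   sequences.  The bound in [A11_bounded_functional] makes L compatible with
   this identification. *)
Definition A11_cauchy (F : nat -> {poly R[i]}) : Prop :=
  forall e : R, 0 < e -> exists N, forall m n, (N <= m)%N -> (N <= n)%N ->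
    A11_norm (F m - F n) < e.

Definition A11_completion_norm (F : nat -> {poly R[i]}) : R :=
  limn (fun n => A11_norm (F n)).

Definition A11_bounded_functional (L : (nat -> {poly R[i]}) -> R[i]) : Prop :=
  (forall (c : R[i]) F G, A11_cauchy F -> A11_cauchy G ->
     L (fun n => c *: F n + G n) = c * L F + L G) /\
  (exists K : R, forall F, A11_cauchy F ->
     Normc.normc (L F) <= K * A11_completion_norm F).

(* b_n n^(-s) *)
Definition dirichlet_term (b : nat -> R[i]) (s : R[i]) (n : nat) : R[i] :=
  let t := complex.Im s * ln n%:R in
  b n * (n%:R `^ (- complex.Re s))%:C%C * (cos t -i* sin t)%C.

Definition dirichlet_series_cvg (b : nat -> R[i]) (s : R[i]) : Prop :=
  cvgn (fun N => \sum_(1 <= n < N) complex.Re (dirichlet_term b s n)) /\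
  cvgn (fun N => \sum_(1 <= n < N) complex.Im (dirichlet_term b s n)).

(* Convergence in some half-plane. *)
Definition dirichlet_series : set (nat -> R[i]) :=
  [set b | exists sigma : R, forall s : R[i],
     sigma < complex.Re s -> dirichlet_series_cvg b s].

Definition A11_dual : set (nat -> R[i]) :=
  [set phi | dirichlet_series phi /\
     exists L, A11_bounded_functional L /\
       forall f : {poly R[i]}, L (fun=> f) = A21_pairing f phi].

Definition A21_sqnorm (a : nat -> R[i]) : \bar R :=
  (\sum_(1 <= n <oo) (Normc.normc (a n) ^+ 2 / (numdiv n)%:R)%:E)%E.

Definition A21 : set (nat -> R[i]) := [set a | (A21_sqnorm a < +oo)%E].

Definition A21_norm (a : nat -> R[i]) : R := Num.sqrt (fine (A21_sqnorm a)).

(* Coefficients of T_g f. *)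
Definition volterra (g f : nat -> R[i]) (n : nat) : R[i] :=
  ((ln n%:R : R)^-1)%:C%C *
  \sum_(k <- divisors n | (k < n)%N)
    f k * g (n %/ k)%N * (ln (n %/ k)%:R : R)%:C%C.

Definition volterra_bounded (g : nat -> R[i]) : Prop :=
  exists K : R, forall f, A21 f ->
    A21 (volterra g f) /\ A21_norm (volterra g f) <= K * A21_norm f.

(* The space X(A^2_1). *)
Definition volterra_symbols : set (nat -> R[i]) :=
  [set g | dirichlet_series g /\ volterra_bounded g].

End bergman.

(* Main.v *)
Require Import Defs.
From HB Require Import structures.
From mathcomp Require Import all_boot all_order all_algebra.
From mathcomp Require Import complex.
From mathcomp Require Import all_classical all_reals all_analysis.
From mathcomp Require Import measurable_realfun.
From mathcomp Require Import ring lra.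

Set Implicit Arguments.
Unset Strict Implicit.
Unset Printing Implicit Defensive.
Import Order.TTheory GRing.Theory Num.Theory.
Import numFieldNormedType.Exports.

Local Open Scope classical_set_scope.
Local Open Scope ring_scope.

(** The counterexample is supported on the primorials [N_k], the products of the
    first [k] primes: [g = \sum_k r^k N_k^(-s)] with [r = 5 / 4].

    The Bohr lift of [N_k^(-s)] is the monomial [z_1 ... z_k].  It extracts the
    coefficient of [N_k^(-s)] from a Dirichlet polynomial [f] up to the factor
    [1 / d(N_k) = 2^(-k)] in the pairing, so the pairing of [f] with [g] is the
    sum of the [(r / 2)^k a_(N_k)].  The coefficient itself is controlled by
    averaging.  The measure on the polydisk is invariant under rotations of each
    variable, hence replacing [f] by a mean of rotated copies does not increase
    its norm, and suitable means remove any given coefficient other than the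
    chosen one ([kill_coefficient]).  What remains is a single monomial, so
    [|a_(N_k)| * ||z_1 ... z_k||_1 <= ||f||_1] ([A11_norm_monomial_le]).  Since
    the mean of [|z|] over the disk is [2 / 3], the norm of the monomial is
    [(2 / 3)^k], and the pairing is bounded as soon as [r / 2 * (3 / 2) < 1],
    that is [r < 4 / 3].  The proof only uses that the mean of [|z|] is at least
    [16 / 25], which is enough for [r = 5 / 4] and follows from the areas of
    annuli ([A11_norm_primorial_ge], [radius_mean20_ge]).

    On the other hand [T_g] maps [N_k^(-s)] to a series whose coefficient at
    [N_k^2] is [r^k / 2], because [log N_k / log N_k^2 = 1 / 2].  As
    [d(N_k) = 2^k] and [d(N_k^2) = 3^k], the squared norm grows at least by the
    factor [r^(2 k) 2^k / (4 * 3^k) = (25 / 24)^k / 4], which is unbounded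
    ([dirichlet_symbol_volterra_unbounded]).  The window
    [3 / 2 < r^2 < 16 / 9] for [r] is what separates the two spaces. *)

(** * Area under linear maps of the plane *)

(** The image measure with its measure structure, which depends on the proof
    that the map is measurable. *)
Definition image_measure d1 d2 (T1 : measurableType d1) (T2 : measurableType d2)
    (R : realType) (m : {measure set T1 -> \bar R}) (f : T1 -> T2)
    (mf : measurable_fun [set: T1] f) : {measure set T2 -> \bar R} :=
  measure_function_pushforward__canonical__measure_function_Measure m mf.

Section planar_maps.
Context {R : realType}.
Local Notation RR := (measurableTypeR R).
Local Notation lambda := (@lebesgue_measure R).
Local Notation planar := (@planar_measure R).

Let measurable_affine (a b : R) :
  measurable_fun [set: RR] (fun x : RR => a * x + b : RR).
Proof. by apply: measurable_funD => //; exact: measurable_funM. Qed.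

(** Lebesgue measure is determined by its values on intervals, and the preimage
    of an interval is an interval. *)
Lemma lebesgue_measure_affine (a b : R) (A : set RR) : 0 < a -> measurable A ->
  lambda ((fun x => a * x + b) @^-1` A) = (a^-1%:E * lambda A)%E.
Proof.
move=> a0 mA; have an0 : a != 0 by rewrite gt_eqF.
pose nu : {measure set RR -> \bar R} :=
  mscale (NngNum (ltW a0)) (image_measure lambda (measurable_affine a b)).
suff -> : lambda A = nu A.
  by rewrite /nu /mscale /= muleA -EFinM mulVf// mul1e.
apply: lebesgue_measure_unique mA => _ [[x y] _ <-].
change (lambda `]x, y]%classic =
  (a%:E * lambda ((fun z => a * z + b)%R @^-1` `]x, y]%classic))%E).
rewrite [X in (_ * lambda X)%E](_ : _ = `](x - b) / a, (y - b) / a]%classic);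
  last first.
  apply/seteqP; split => z; rewrite /= !in_itv/= ltr_pdivrMr// ler_pdivlMr//;
  by rewrite ltrBlDr lerBrDr (mulrC z).
rewrite !lebesgue_measure_itv/= !lte_fin ltr_pM2r ?invr_gt0// ltrD2r.
case: ifPn => _; last by rewrite mule0.
by rewrite -!EFinD -EFinM; congr (_%:E); field.
Qed.

Let measurable_lin (a b : R) : measurable_fun [set: RR * RR]
  (fun z : RR * RR => a * z.1 + b * z.2 : RR).
Proof. by apply: measurable_funD; apply: measurable_funM. Qed.

Lemma measurable_linear_map (a b c d : R) : measurable_fun [set: RR * RR]
  (fun z : RR * RR => (a * z.1 + b * z.2, c * z.1 + d * z.2) : RR * RR).
Proof. by apply/measurable_fun_pairP; split; exact: measurable_lin. Qed.

(** On the line [z.2 = y] the map is [x |-> a x + b y]. *)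
Lemma planar_measure_map1 (a b : R) (A : set (RR * RR)) : 0 < a ->
  measurable A ->
  planar ((fun z : RR * RR => (a * z.1 + b * z.2, z.2)) @^-1` A) =
  (a^-1%:E * planar A)%E.
Proof.
move=> a0 mA.
have pE B : measurable B -> planar B = (\int[lambda]_y lambda (ysection B y))%E.
  move=> mB; apply: (@product_measure_unique _ _ _ _ _ lambda lambda
    (lambda \x^ lambda)%E) => // X Y mX mY; exact: product_measure2E.
have mfA : measurable ((fun z : RR * RR => (a * z.1 + b * z.2, z.2)) @^-1` A).
  have /(_ measurableT _ mA) := measurable_linear_map a b 0 1.
  by rewrite setTI; congr measurable; apply/seteqP; split => -[x y] /=;
    rewrite mul0r mul1r add0r.
rewrite !pE// -ge0_integralZl//; last 2 first.
  exact: measurable_fun_ysection.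
  by rewrite lee_fin invr_ge0 ltW.
apply: eq_integral => y _.
rewrite -(@lebesgue_measure_affine a (b * y))//.
exact: measurable_ysection.
Qed.

(** On the line [z.1 = x] the map is [y |-> b y + a x]. *)
Lemma planar_measure_map2 (a b : R) (A : set (RR * RR)) : 0 < b ->
  measurable A ->
  planar ((fun z : RR * RR => (z.1, a * z.1 + b * z.2)) @^-1` A) =
  (b^-1%:E * planar A)%E.
Proof.
move=> b0 mA.
have mfA : measurable ((fun z : RR * RR => (z.1, a * z.1 + b * z.2)) @^-1` A).
  have /(_ measurableT _ mA) := measurable_linear_map 1 0 a b.
  by rewrite setTI; congr measurable; apply/seteqP; split => -[x y] /=;
    rewrite mul0r mul1r addr0.
rewrite /planar_measure /product_measure1 -ge0_integralZl//; last 2 first.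
  exact: measurable_fun_xsection.
  by rewrite lee_fin invr_ge0 ltW.
apply: eq_integral => x _ /=.
rewrite -(@lebesgue_measure_affine b (a * x))//;
  last exact: measurable_xsection.
congr (lambda _); apply/seteqP; split => y /=;
  rewrite /xsection/= !inE/= addrC//.
Qed.

End planar_maps.

(** * Rotations of the disk and areas of annuli *)

Section disk_measure.
Context {R : realType}.
Local Notation RR := (measurableTypeR R).
Local Notation planar := (@planar_measure R).

Definition rotate (c s : R) (z : RR * RR) : RR * RR :=
  (c * z.1 - s * z.2, s * z.1 + c * z.2).

Lemma measurable_rotate (c s : R) : measurable_fun [set: RR * RR] (rotate c s).
Proof.
have := @measurable_linear_map R c (- s) s c.
by apply: eq_measurable_fun => z _; rewrite /rotate mulNr.
Qed.

Lemma measurable_rotate_preimage (c s : R) (A : set (RR * RR)) :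
  measurable A -> measurable (rotate c s @^-1` A).
Proof.
by move=> mA; have := measurable_rotate c s measurableT mA; rewrite setTI.
Qed.

(** A rotation by an angle other than [pi] is a product of three shears, which
    preserve area; the rotation by [pi] is the square of a quarter turn. *)
Lemma planar_measure_rotate (c s : R) (A : set (RR * RR)) :
  c ^+ 2 + s ^+ 2 = 1 -> measurable A -> planar (rotate c s @^-1` A) = planar A.
Proof.
wlog c1 : c s A / c != -1.
  move=> shears cs1 mA; have [c1|/shears] := eqVneq c (-1); last exact.
  have s0 : s = 0.
    by move: cs1; rewrite c1 => ?; apply/eqP; rewrite -sqrf_eq0; apply/eqP; lra.
  have -> : rotate c s @^-1` A = rotate 0 1 @^-1` (rotate 0 1 @^-1` A).
    apply/seteqP; split => -[x y]; rewrite /rotate/= c1 s0;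
    by rewrite ?mulN1r !mul0r !mul1r ?sub0r ?subr0 ?add0r ?addr0.
  by rewrite !shears ?expr0n ?expr1n ?add0r// ?eqr_oppLR ?(eq_sym 0)
    ?oppr_eq0 ?oner_eq0//;
    exact: measurable_rotate_preimage.
move=> cs1 mA; have d0 : 1 + c != 0 by rewrite addrC -[1]opprK subr_eq0.
(* [t] is minus the tangent of half the angle. *)
pose t := - (s / (1 + c)).
pose H (z : RR * RR) : RR * RR := (1 * z.1 + t * z.2, z.2).
pose V (z : RR * RR) : RR * RR := (z.1, s * z.1 + 1 * z.2).
have mH B : measurable B -> measurable (H @^-1` B).
  move=> mB; have /(_ measurableT _ mB) := @measurable_linear_map R 1 t 0 1.
  by rewrite setTI; congr measurable; apply/seteqP; split => -[x y] /=;
    rewrite /H/= mul0r !mul1r add0r.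
have mV B : measurable B -> measurable (V @^-1` B).
  move=> mB; have /(_ measurableT _ mB) := @measurable_linear_map R 1 0 s 1.
  by rewrite setTI; congr measurable; apply/seteqP; split => -[x y] /=;
    rewrite /V/= mul0r !mul1r addr0.
have -> : rotate c s @^-1` A = H @^-1` (V @^-1` (H @^-1` A)).
  have E z : rotate c s z = H (V (H z)).
    have qc : s / (1 + c) * (1 + c) = s by rewrite divfK.
    have sq : s * (s / (1 + c)) = 1 - c.
      have s2 : s ^+ 2 = 1 - c ^+ 2 by lra.
      by rewrite mulrA -expr2 s2; field.
    move: qc sq; rewrite /rotate /H /V /t; move: (s / (1 + c)) => q qc sq.
    congr (_, _) => /=; last first.
      transitivity (s * z.1 + (1 - s * q) * z.2); last by ring.
      by rewrite sq; ring.
    transitivity ((1 - s * q) * z.1 - (q * (2 - s * q)) * z.2); last by ring.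
    rewrite sq (_ : q * (2 - (1 - c)) = s)//; first by ring.
    by rewrite -[RHS]qc; ring.
  by rewrite (_ : rotate c s = H \o V \o H)//; apply/funext => z; exact: E.
rewrite planar_measure_map1//; last exact: mV (mH _ mA).
rewrite planar_measure_map2//; last exact: mH.
by rewrite planar_measure_map1// !invr1 !mul1e.
Qed.

(** The total area is positive and finite, so normalizing is dividing by it. *)
Lemma disk_measureE (A : set (RR * RR)) : measurable A ->
  @disk_measure R A =
  (planar (A `&` unit_disk) * (fine (planar unit_disk))^-1%:E)%E.
Proof.
move=> mA; have /andP[d0 doo] := @planar_measure_disk R.
have E : mrestr planar measurable_unit_disk setT = planar unit_disk.
  by rewrite /mrestr setTI.
change (mnormalize (mrestr planar measurable_unit_disk)
  (\d_ point : probability (RR * RR)%type R) A =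
  (planar (A `&` unit_disk) * (fine (planar unit_disk))^-1%:E)%E).
rewrite /mnormalize [X in X == 0%E]E [X in X == +oo%E]E.
by rewrite (gt_eqF d0) (lt_eqF doo) /= [X in fine X]E.
Qed.

Lemma rotate_norm (c s : R) z : c ^+ 2 + s ^+ 2 = 1 ->
  (rotate c s z).1 ^+ 2 + (rotate c s z).2 ^+ 2 = z.1 ^+ 2 + z.2 ^+ 2.
Proof.
by move=> cs1; rewrite -[RHS]mul1r -cs1 /rotate/=; ring.
Qed.

Lemma disk_measure_rotate (c s : R) (A : set (RR * RR)) :
  c ^+ 2 + s ^+ 2 = 1 -> measurable A ->
  @disk_measure R (rotate c s @^-1` A) = @disk_measure R A.
Proof.
move=> cs1 mA; rewrite !disk_measureE//; last exact: measurable_rotate_preimage.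
congr (_ * _)%E; rewrite -[RHS](planar_measure_rotate cs1); last first.
  by apply: measurableI => //; exact: measurable_unit_disk.
congr (planar _); rewrite preimage_setI; congr (_ `&` _).
by apply/seteqP; split => z; rewrite /unit_disk /= rotate_norm.
Qed.

Definition outer (r : R) : set (RR * RR) :=
  [set z | r ^+ 2 <= z.1 ^+ 2 + z.2 ^+ 2].

Lemma measurable_outer r : measurable (outer r).
Proof.
rewrite [X in measurable X](_ : _ =
  (fun z : RR * RR => z.1 ^+ 2 + z.2 ^+ 2 : R) @^-1` `[r ^+ 2, +oo[%classic).
  rewrite -[X in measurable X]setTI.
  apply: (_ : measurable_fun setT _) => //.
  apply: measurable_funD; apply: measurable_funX.
    exact: measurable_fst.
  exact: measurable_snd.
by apply/seteqP; split => z; rewrite /outer /= in_itv/= andbT.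
Qed.

(** The complement of [outer r] is the disk of radius [r], which is the preimage
    of the unit disk under the scaling by [r^-1] in both coordinates. *)
Lemma disk_measure_outer (r : R) : 0 < r <= 1 ->
  @disk_measure R (outer r) = (1 - r ^+ 2)%:E.
Proof.
move=> /andP[r0 r1]; have rn0 : r != 0 by rewrite gt_eqF.
have mO := measurable_outer r; have mD := @measurable_unit_disk R.
rewrite -[outer r]setCK probability_setC; last exact: measurableC.
rewrite EFinB; congr (_ - _)%E.
rewrite disk_measureE; last exact: measurableC.
pose S1 (z : RR * RR) : RR * RR := (r^-1 * z.1 + 0 * z.2, z.2).
pose S2 (z : RR * RR) : RR * RR := (z.1, 0 * z.1 + r^-1 * z.2).
have -> : ~` outer r `&` unit_disk = S1 @^-1` (S2 @^-1` unit_disk).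
  apply/seteqP; split => -[x y]; rewrite /S1 /S2 /outer /unit_disk /=
    !mul0r addr0 add0r !exprMn -mulrDr exprVn ltr_pdivrMl ?exprn_gt0// mulr1.
    by move=> [/negP]; rewrite -ltNge.
  move=> xyr; split; first by apply/negP; rewrite -ltNge.
  by apply: lt_le_trans xyr _; rewrite expr_le1// ltW.
rewrite planar_measure_map1 ?invr_gt0//; last first.
  have /(_ measurableT _ mD) := @measurable_linear_map R 1 0 0 r^-1.
  by rewrite setTI; congr measurable; apply/seteqP; split => -[x y] /=;
    rewrite /S2/= !mul0r !mul1r addr0.
rewrite planar_measure_map2 ?invr_gt0// invrK muleA -EFinM -muleA.
have /andP[d0 doo] := @planar_measure_disk R.
have df : planar unit_disk \is a fin_num by rewrite ge0_fin_numE// ltW.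
have dn0 : fine (planar unit_disk) != 0 by rewrite gt_eqF// fine_gt0// d0.
rewrite -[X in (_ * (X * _))%E](fineK df) -EFinM divff// mulr1.
by rewrite expr2.
Qed.

End disk_measure.

(** * Maps of one coordinate under a product measure *)

Section infprod_coordinate_map.
Context d (T : measurableType d) (R : realType) (P : probability T R).
Local Notation S := (seqspace T).

Definition rectangle (n : nat) (B : nat -> set T) : set S :=
  [set x | forall i, (i < n)%N -> B i (x i)].

Lemma measurable_coordinate i : measurable_fun [set: S] (fun x : S => x i).
Proof.
move=> _ B mB; rewrite setTI; apply: sub_sigma_algebra.
by exists i, B.
Qed.

Lemma measurable_rectangle n (B : nat -> set T) :
  (forall i, measurable (B i)) -> measurable (rectangle n B).
Proof.
move=> mB.
have -> : rectangle n B =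
    \bigcap_(i in [set i | (i < n)%N]) ((fun x : S => x i) @^-1` B i).
  by apply/seteqP; split.
apply: bigcap_measurableType => i _.
by rewrite -[X in measurable X]setTI; exact: measurable_coordinate.
Qed.

Let rectangles : set (set S) :=
  [set A | exists n B, (forall i, measurable (B i)) /\ A = rectangle n B].

Let measurable_rectangles : @measurable _ S = <<s rectangles >>.
Proof.
apply/seteqP; split; last first.
  apply: smallest_sub; first exact: sigma_algebra_measurable.
  by move=> _ [n [B [mB ->]]]; exact: measurable_rectangle.
apply: smallest_sub; first exact: smallest_sigma_algebra.
move=> _ [i [B [mB ->]]]; apply: sub_sigma_algebra.
exists i.+1, (fun k => if k == i then B else setT); split.
  by move=> k; case: ifP.
apply/seteqP; split => x /=.
  by move=> Bx k _; case: eqP => // ->.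
by move=> /(_ i (ltnSn i)); rewrite eqxx.
Qed.

Let setI_rectangles : setI_closed rectangles.
Proof.
move=> _ _ [m [B [mB ->]]] [n [C [mC ->]]].
exists (maxn m n), (fun i => (if (i < m)%N then B i else setT) `&`
                    (if (i < n)%N then C i else setT)); split.
  by move=> i; apply: measurableI; case: ifP.
apply/seteqP; split => x /=.
  move=> [Bx Cx] i _; split; first by case: ifP => // /Bx.
  by case: ifP => // /Cx.
move=> BCx; split=> i im; have := BCx i; rewrite leq_max im ?orbT => /(_ isT)[].
  by [].
by [].
Qed.

Definition map_coordinate (j : nat) (phi : T -> T) (x : S) : S :=
  fun i => if i == j then phi (x i) else x i.

Lemma measurable_map_coordinate j (phi : T -> T) :
  measurable_fun [set: T] phi ->
  measurable_fun [set: S] (map_coordinate j phi).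
Proof.
move=> mphi; apply: (@measurability _ _ S S setT _ (@seq_cylinders _ T) erefl).
move=> _ [_ [i [B [mB ->]]] <-].
rewrite setTI /map_coordinate; have [->|ij] := eqVneq i j.
  have := measurableT_comp mphi (@measurable_coordinate j).
  move=> /(_ measurableT _ mB); rewrite setTI.
  by congr measurable; apply/seteqP; split => x /=; rewrite eqxx.
have := @measurable_coordinate i measurableT _ mB; rewrite setTI.
by congr measurable; apply/seteqP; split => x /=; rewrite (negbTE ij).
Qed.

(** A measure is determined by its values on the rectangles, and a map of one
    coordinate sends a rectangle to a rectangle. *)
Lemma infprod_map_coordinate j (phi : T -> T) (A : set S) :
  measurable_fun [set: T] phi ->
  (forall B, measurable B -> P (phi @^-1` B) = P B) ->
  measurable A -> infprod P (map_coordinate j phi @^-1` A) = infprod P A.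
Proof.
move=> mphi Pphi mA.
pose nu := image_measure (infprod P) (measurable_map_coordinate j mphi).
suff -> : infprod P A = nu A by [].
apply: (measure_unique rectangles (fun=> setT)) => //.
- move=> _; exists 0%N, (fun=> setT); split=> //.
  by apply/seteqP; split.
- by rewrite bigcup_const//; exists 0%N.
- move=> _ [n [B [mB ->]]].
  pose B' i := if i == j then phi @^-1` B i else B i.
  change (infprod P (rectangle n B) =
          infprod P (map_coordinate j phi @^-1` rectangle n B)).
  have -> : map_coordinate j phi @^-1` rectangle n B = rectangle n B'.
    by apply/seteqP; split => x /= Bx i ni; have := Bx i ni;
      rewrite /map_coordinate /B'; case: ifP.
  rewrite !infprodE// => [|i]; last first.
    rewrite /B'; case: ifP => // _; rewrite -[X in measurable X]setTI.
    exact: (mphi measurableT _ (mB i)).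
  by apply: eq_bigr => i _; rewrite /B'; case: ifP => // _; rewrite Pphi.
- move=> _.
  by rewrite [X in (X < _)%E](@probability_setT _ _ _ (infprod P)) ltry.
Qed.

End infprod_coordinate_map.

(** * Primorials and their divisors *)

Section primorial.
Local Open Scope nat_scope.

Lemma nth_prime_ltnS j : nth_prime j < nth_prime j.+1.
Proof. by rewrite /=; case: ex_minnP => p /andP[]. Qed.

Lemma nth_prime_inj : injective nth_prime.
Proof.
have mono i j : i < j -> nth_prime i < nth_prime j.
  exact: (homo_ltn ltn_trans nth_prime_ltnS).
move=> i j ij; have [/mono|/mono|//] := ltngtP i j; by rewrite ij ltnn.
Qed.

(** Unique factorization, for the sequence of exponents. *)
Lemma eq_from_kappa m n : 0 < m -> 0 < n -> kappa m =1 kappa n -> m = n.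
Proof.
move=> m0 n0 mn; apply: eqn_from_log => // p.
have [pp|np] := boolP (prime p); last first.
  by rewrite /logn (negbTE np).
by have [j <-] := nth_prime_surj pp; exact: mn.
Qed.

Definition primorial m := \prod_(j < m) nth_prime j.

Lemma primorial_gt0 m : 0 < primorial m.
Proof. by apply: prodn_gt0 => j; exact: prime_gt0 (prime_nth_prime j). Qed.

Lemma primorialS m : primorial m.+1 = primorial m * nth_prime m.
Proof. by rewrite /primorial big_ord_recr. Qed.

Lemma leq_exp2_primorial m : 2 ^ m <= primorial m.
Proof.
elim: m => [|m ih]; first by rewrite /primorial big_ord0.
by rewrite primorialS expnSr leq_mul// prime_gt1// prime_nth_prime.
Qed.

Lemma ltn_primorial m : m < primorial m.
Proof. exact: leq_trans (ltn_expl m (ltnSn 1)) (leq_exp2_primorial m). Qed.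

Lemma primorial_inj : injective primorial.
Proof.
have mono i j : i < j -> primorial i < primorial j.
  apply: (homo_ltn ltn_trans) => {i j} i; rewrite primorialS.
  rewrite -[X in X < _]muln1 ltn_pmul2l ?primorial_gt0// prime_gt1//.
  exact: prime_nth_prime.
move=> i j ij; have [/mono|/mono|//] := ltngtP i j; by rewrite ij ltnn.
Qed.

Lemma kappa_primorial m j : kappa (primorial m) j = (j < m).
Proof.
rewrite /kappa; elim: m => [|m ih]; first by rewrite /primorial big_ord0 logn1.
rewrite primorialS lognM ?primorial_gt0 ?prime_gt0 ?prime_nth_prime// ih.
rewrite logn_prime ?prime_nth_prime// (inj_eq nth_prime_inj) ltnS.
by rewrite (leq_eqVlt j); have [->|] := eqVneq j m; rewrite ?ltnn ?addn0.
Qed.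

(** A divisor of [n * p ^ a] is uniquely a divisor of [n] times a power of [p]
    with exponent at most [a]. *)
Lemma numdiv_mul_prime_power n p a : 0 < n -> prime p -> coprime p n ->
  numdiv (n * p ^ a) = numdiv n * a.+1.
Proof.
move=> n0 pp cpn; rewrite /numdiv.
have pa0 k : 0 < p ^ k by rewrite expn_gt0 prime_gt0.
have cp d k : d %| n -> coprime d (p ^ k).
  move=> dn; apply: coprimeXr; rewrite coprime_sym; exact: coprime_dvdr dn cpn.
rewrite -[a.+1](size_iota 0) -(size_allpairs (fun d k => d * p ^ k)).
apply: perm_size; apply: uniq_perm; first exact: divisors_uniq.
  apply: allpairs_uniq; [exact: divisors_uniq|exact: iota_uniq|].
  move=> [d k] [e l] dk el /= E.
  have /allpairsP[[d' k'] /= [dn _ [dd' kk']]] := dk.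
  have /allpairsP[[e' l'] /= [en _ [ee' ll']]] := el.
  rewrite {dk el}dd' kk' ee' ll' {dd' kk' ee' ll' d k e l} in E *.
  rewrite -dvdn_divisors// in dn; rewrite -dvdn_divisors// in en.
  have de : d' = e'.
    apply/eqP; rewrite eqn_dvd.
    rewrite -(Gauss_dvdl e' (cp d' l' dn)) -(Gauss_dvdl d' (cp e' k' en)).
    by rewrite -E dvdn_mulr//= E dvdn_mulr.
  move: E; rewrite de => /eqP; rewrite eqn_pmul2l ?(dvdn_gt0 n0 en)//.
  by rewrite eqn_exp2l ?prime_gt1// => /eqP ->.
move=> x; rewrite -dvdn_divisors ?muln_gt0 ?n0 ?pa0//; apply/idP/allpairsP.
  move=> xn; have x0 : 0 < x by apply: dvdn_gt0 xn; rewrite muln_gt0 n0 pa0.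
  have [m pm xE] := pfactor_coprime pp x0.
  exists (m, logn p x); split=> [||//].
    change (m \in divisors n).
    rewrite -dvdn_divisors// -(@Gauss_dvdl m n (p ^ a)).
      by apply: dvdn_trans xn; rewrite xE dvdn_mulr.
    by apply: coprimeXr; rewrite coprime_sym.
  change (logn p x \in iota 0 a.+1); rewrite mem_iota add0n ltnS.
  apply: leq_trans (dvdn_leq_log p _ xn) _; first by rewrite muln_gt0 n0 pa0.
  by rewrite logn_Gauss// pfactorK.
move=> [[d k] [dn]]; rewrite mem_iota add0n ltnS => /= ka ->.
by rewrite -dvdn_divisors// in dn; rewrite dvdn_mul// dvdn_exp2l.
Qed.

Lemma numdiv_primorialX m a : numdiv (primorial m ^ a) = a.+1 ^ m.
Proof.
elim: m => [|m ih]; first by rewrite /primorial big_ord0 exp1n.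
rewrite primorialS expnMn numdiv_mul_prime_power ?expn_gt0 ?primorial_gt0//.
- by rewrite ih expnSr.
- exact: prime_nth_prime.
- apply: coprimeXr; rewrite prime_coprime ?prime_nth_prime//.
  have := kappa_primorial m m; rewrite ltnn /kappa => /eqP.
  rewrite -leqn0 leqNgt logn_gt0 mem_primes prime_nth_prime primorial_gt0.
  by [].
Qed.

End primorial.

(** * Bohr lifts and the norm of A^1_1 *)

Section normc.
Context {R : realType}.
Implicit Types z w : R[i].
Import Normc.

Lemma normc_ge0 z : 0 <= normc z.
Proof. by case: z => a b; exact: sqrtr_ge0. Qed.

Lemma normc_real (x : R) : normc x%:C%C = `|x|.
Proof. by rewrite /= expr0n/= addr0 sqrtr_sqr. Qed.

Lemma normcX z n : normc (z ^+ n) = normc z ^+ n.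
Proof.
elim: n => [|n ih]; first by rewrite !expr0 normc1.
by rewrite !exprS normcM ih.
Qed.

Lemma normc_prod (I : Type) (r : seq I) (P : pred I) (F : I -> R[i]) :
  normc (\prod_(i <- r | P i) F i) = \prod_(i <- r | P i) normc (F i).
Proof.
elim/big_ind2: _ => [|z x w y <- <-|//]; first exact: normc1.
exact: normcM.
Qed.

Lemma le_normc_sum (I : Type) (r : seq I) (P : pred I) (F : I -> R[i]) :
  normc (\sum_(i <- r | P i) F i) <= \sum_(i <- r | P i) normc (F i).
Proof.
elim/big_ind2: _ => [|x a y b xa yb|//]; first by rewrite normc0.
exact: le_trans (le_normcD _ _) (lerD xa yb).
Qed.

Lemma normc_unit (c s : R) : normc (c +i* s)%C = 1 -> c ^+ 2 + s ^+ 2 = 1.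
Proof.
move=> /= /(congr1 (fun x => x ^+ 2)).
by rewrite sqr_sqrtr ?addr_ge0 ?sqr_ge0// expr1n.
Qed.

Lemma normc2 : normc (2 : R[i]) = 2.
Proof.
have -> : (2 : R[i]) = (2%:R)%:C%C by rewrite rmorph_nat.
by rewrite normc_real ger0_norm.
Qed.

Lemma normr_Re z : `|complex.Re z| <= normc z.
Proof.
case: z => a b /=; rewrite -sqrtr_sqr; apply: ler_wsqrtr.
by rewrite lerDl sqr_ge0.
Qed.

Lemma normr_Im z : `|complex.Im z| <= normc z.
Proof.
case: z => a b /=; rewrite -sqrtr_sqr; apply: ler_wsqrtr.
by rewrite lerDr sqr_ge0.
Qed.

Lemma normc_le_ReIm z : normc z <= `|complex.Re z| + `|complex.Im z|.
Proof.
case: z => a b /=.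
rewrite -(@ler_sqr _ (Num.sqrt _)) ?nnegrE ?sqrtr_ge0 ?addr_ge0//.
rewrite sqr_sqrtr ?addr_ge0 ?sqr_ge0// sqrrD !real_normK ?num_real//.
by rewrite addrAC lerDl mulrn_wge0// mulr_ge0.
Qed.

End normc.

Section bohr_lift.
Context {R : realType}.
Local Notation RR := (measurableTypeR R).
Local Notation S := (seqspace (RR * RR)%type).
Local Notation mu := (@polydisk_measure R).
Import Normc.

Definition complex_measurable (F : S -> R[i]) :=
  measurable_fun [set: S] (fun x => complex.Re (F x) : R) /\
  measurable_fun [set: S] (fun x => complex.Im (F x) : R).

Lemma complex_measurable_cst c : complex_measurable (fun=> c).
Proof. by split; exact: measurable_cst. Qed.

Lemma complex_measurableD F G : complex_measurable F -> complex_measurable G ->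
  complex_measurable (fun x => F x + G x).
Proof.
move=> [F1 F2] [G1 G2]; split.
  apply: eq_measurable_fun (measurable_funD F1 G1) => x _ /=.
  by case: (F x) (G x) => a b [c d].
apply: eq_measurable_fun (measurable_funD F2 G2) => x _ /=.
by case: (F x) (G x) => a b [c d].
Qed.

Lemma complex_measurableM F G : complex_measurable F -> complex_measurable G ->
  complex_measurable (fun x => F x * G x).
Proof.
move=> [F1 F2] [G1 G2]; split.
  apply: eq_measurable_fun (measurable_funB
    (measurable_funM F1 G1) (measurable_funM F2 G2)) => x _ /=.
  by case: (F x) (G x) => a b [c d].
apply: eq_measurable_fun (measurable_funD
  (measurable_funM F1 G2) (measurable_funM F2 G1)) => x _ /=.
by case: (F x) (G x) => a b [c d].
Qed.

Lemma complex_measurableX F n : complex_measurable F ->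
  complex_measurable (fun x => F x ^+ n).
Proof.
move=> mF; elim: n => [|n ih]; first exact: complex_measurable_cst.
by under eq_fun do rewrite exprS; exact: complex_measurableM.
Qed.

Lemma measurable_normc F : complex_measurable F ->
  measurable_fun [set: S] (fun x => normc (F x) : R).
Proof.
move=> [F1 F2].
have : measurable_fun [set: S]
    (fun x => Num.sqrt (complex.Re (F x) ^+ 2 + complex.Im (F x) ^+ 2)).
  apply: measurableT_comp.
    apply: continuous_measurable_fun; exact: sqrt_continuous.
  by apply: measurable_funD; apply: measurable_funX.
by apply: eq_measurable_fun => x _; case: (F x).
Qed.

Definition to_complex (z : R * R) : R[i] := (z.1 +i* z.2)%C.

Lemma complex_measurable_coordinate j :
  complex_measurable (fun x : S => to_complex (x j)).
Proof.
have mj : measurable_fun [set: S] (fun x : S => x j).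
  exact: measurable_coordinate.
by split; [exact: measurableT_comp measurable_fst mj|
           exact: measurableT_comp measurable_snd mj].
Qed.

Lemma complex_measurable_bohr_monomial n :
  complex_measurable (fun x : S => bohr_monomial n x).
Proof.
rewrite /bohr_monomial; elim: (index_enum _) => [|i s ih].
  by under eq_fun do rewrite big_nil; exact: complex_measurable_cst.
under eq_fun do rewrite big_cons; apply: complex_measurableM => //.
by apply: complex_measurableX; exact: complex_measurable_coordinate.
Qed.

Lemma complex_measurable_bohr_lift f :
  complex_measurable (fun x : S => bohr_lift f x).
Proof.
rewrite /bohr_lift; elim: (index_enum _) => [|i s ih].
  by under eq_fun do rewrite big_nil; exact: complex_measurable_cst.
under eq_fun do rewrite big_cons; apply: complex_measurableD => //.
apply: complex_measurableM; first exact: complex_measurable_cst.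
exact: complex_measurable_bohr_monomial.
Qed.

Lemma normc_bohr_monomial_le1 n x : polydisk x ->
  normc (bohr_monomial n x) <= 1 :> R.
Proof.
move=> Dx; rewrite normc_prod; apply: numdomain.Num.Theory.prodr_ile1 => j _.
rewrite normcX exprn_ge0 ?normc_ge0//.
apply: exprn_ile1; first exact: normc_ge0.
rewrite -[leRHS]sqrtr1; apply: ler_wsqrtr; apply: ltW; exact: Dx.
Qed.

Lemma measurable_polydisk : measurable (polydisk : set S).
Proof.
have -> : polydisk = \bigcap_j ((fun x : S => x j) @^-1` @unit_disk R).
  by apply/seteqP; split => x Dx j => [_|]; [exact: Dx|exact: (Dx j I)].
apply: bigcapT_measurable => j; rewrite -[X in measurable X]setTI.
by apply: measurable_coordinate => //; exact: measurable_unit_disk.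
Qed.

Lemma integrable_bohr_lift f :
  mu.-integrable polydisk (EFin \o (fun x : S => normc (bohr_lift f x))).
Proof.
pose M := \sum_(m < size f) normc f`_m.
apply: (@le_integrable _ _ _ _ _ _ _ (EFin \o cst M)).
- exact: measurable_polydisk.
- apply/measurable_EFinP; apply: measurable_funTS.
  exact: (measurable_normc (complex_measurable_bohr_lift f)).
- move=> x Dx /=; rewrite lee_fin !ger0_norm ?normc_ge0//; last first.
    by apply: sumr_ge0 => m _; exact: normc_ge0.
  apply: le_trans (le_normc_sum _ _ _) _; apply: ler_sum => m _.
  rewrite normcM -[leRHS]mulr1 ler_wpM2l ?normc_ge0//.
  exact: normc_bohr_monomial_le1.
- apply: finite_measure_integrable_cst; exact: measurable_polydisk.
Qed.

(** A common length [N] lets two polynomials be compared coefficientwise. *)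
Lemma bohr_lift_widen N (f : {poly R[i]}) x : (size f <= N)%N ->
  bohr_lift f x = \sum_(m < N) f`_m * bohr_monomial m.+1 x.
Proof.
move=> fN; rewrite /bohr_lift.
rewrite (big_ord_widen N (fun m => f`_m * bohr_monomial m.+1 x) fN).
rewrite big_mkcond /=; apply: eq_bigr => m _; case: ltnP => // fm.
by rewrite nth_default ?mul0r.
Qed.

Lemma bohr_liftD f g x :
  bohr_lift (f + g) x = bohr_lift f x + bohr_lift g x :> R[i].
Proof.
pose N := maxn (size f) (size g).
rewrite !(@bohr_lift_widen N) ?leq_maxl ?leq_maxr ?size_polyD//.
by rewrite -big_split; apply: eq_bigr => m _; rewrite coefD mulrDl.
Qed.

Lemma bohr_liftZ c f x : bohr_lift (c *: f) x = c * bohr_lift f x :> R[i].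
Proof.
rewrite (@bohr_lift_widen (size f)) ?size_scale_leq// mulr_sumr.
by apply: eq_bigr => m _; rewrite coefZ mulrA.
Qed.

Lemma bohr_liftXn m x : bohr_lift 'X^m x = bohr_monomial m.+1 x :> R[i].
Proof.
rewrite /bohr_lift size_polyXn big_ord_recr/= coefXn eqxx mul1r big1 ?add0r//.
by move=> i _; rewrite coefXn (ltn_eqF (ltn_ord i)) mul0r.
Qed.

Lemma A11_norm_ge0 (f : {poly R[i]}) : 0 <= A11_norm f.
Proof. by apply: Rintegral_ge0 => x _; exact: normc_ge0. Qed.

Lemma A11_normD (f g : {poly R[i]}) :
  A11_norm (f + g) <= A11_norm f + A11_norm g.
Proof.
have mD := measurable_polydisk.
rewrite /A11_norm -RintegralD//; [|exact: integrable_bohr_lift..].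
apply: le_Rintegral => //; first exact: integrable_bohr_lift.
  rewrite (_ : _ \o _ = (fun x : S => (normc (bohr_lift f x))%:E +
    (normc (bohr_lift g x))%:E)%E)//.
  by apply: integrableD => //; exact: integrable_bohr_lift.
by move=> x _; rewrite bohr_liftD; exact: le_normcD.
Qed.

Lemma A11_normZ c (f : {poly R[i]}) : A11_norm (c *: f) = normc c * A11_norm f.
Proof.
rewrite /A11_norm -RintegralZl; [|exact: measurable_polydisk|
  exact: integrable_bohr_lift].
by apply: eq_Rintegral => x _; rewrite bohr_liftZ normcM.
Qed.

End bohr_lift.

(** * Extraction of a coefficient *)

Section coefficient_bound.
Context {R : realType}.
Local Notation RR := (measurableTypeR R).
Local Notation S := (seqspace (RR * RR)%type).
Local Notation mu := (@polydisk_measure R).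
Import Normc.

Lemma to_complex_rotate (c s : R) z :
  to_complex (rotate c s z) = (c +i* s)%C * to_complex z.
Proof.
by case: z => x y; rewrite /to_complex /rotate /=; simpc;
  rewrite (addrC (s * x)).
Qed.

Lemma kappa_eq0 n j : (n <= j)%N -> kappa n j = 0%N.
Proof.
by move=> nj; apply: ltn_log0; exact: leq_ltn_trans nj (ltn_nth_prime j).
Qed.

Lemma bohr_monomial_rotate n j (c s : R) (x : S) :
  bohr_monomial n (map_coordinate j (rotate c s) x) =
  (c +i* s)%C ^+ kappa n j * bohr_monomial n x.
Proof.
have E i : to_complex (map_coordinate j (rotate c s) x i) ^+ kappa n i =
    (if i == j then (c +i* s)%C ^+ kappa n j else 1) *
    to_complex (x i) ^+ kappa n i.
  rewrite /map_coordinate; case: eqP => [->|_]; last by rewrite mul1r.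
  by rewrite to_complex_rotate exprMn.
transitivity (\prod_(i < n)
  to_complex (map_coordinate j (rotate c s) x i) ^+ kappa n i).
  by [].
under eq_bigr do rewrite E; rewrite big_split /=; congr (_ * _).
have [jn|nj] := ltnP j n; last first.
  by rewrite kappa_eq0// expr0 big1// => i _; case: ifP.
rewrite (bigD1 (Ordinal jn))//= eqxx big1 ?mulr1// => i.
by rewrite -val_eqE /= => /negbTE ->.
Qed.

(** The polynomial whose Bohr lift is that of [f] after multiplication of the
    [j]-th variable by [u]. *)
Definition twist (j : nat) (u : R[i]) (f : {poly R[i]}) : {poly R[i]} :=
  \poly_(m < size f) (f`_m * u ^+ kappa m.+1 j).

Lemma coef_twist j u f m : (twist j u f)`_m = f`_m * u ^+ kappa m.+1 j.
Proof.
rewrite coef_poly; case: ltnP => // fm.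
by rewrite nth_default ?mul0r.
Qed.

Lemma A11_norm_twist j u (f : {poly R[i]}) : normc u = 1 ->
  A11_norm (twist j u f) = A11_norm f.
Proof.
case: u => c s /normc_unit cs1.
have mD := @measurable_polydisk R.
pose Phi := map_coordinate j (rotate c s).
have mrot := @measurable_rotate R c s.
have mPhi : measurable_fun [set: S] Phi by exact: measurable_map_coordinate.
have mf : measurable_fun [set: S] (fun x : S => normc (bohr_lift f x)).
  exact: measurable_normc (complex_measurable_bohr_lift f).
rewrite /A11_norm /Rintegral; congr fine.
transitivity (\int[pushforward mu Phi]_(x in polydisk)
  (normc (bohr_lift f x))%:E)%E; last first.
  apply: eq_measure_integral => A mA _.
  apply: infprod_map_coordinate => // B mB; exact: disk_measure_rotate.
rewrite ge0_integral_pushforward//; last 2 first.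
- by apply/measurable_EFinP; exact: measurable_funTS.
- by move=> x _; rewrite lee_fin normc_ge0.
have -> : Phi @^-1` polydisk = polydisk.
  apply/seteqP; split => x Dx i; have := Dx i; rewrite /Phi /map_coordinate;
  by case: ifP => // _; rewrite /unit_disk/= rotate_norm.
apply: eq_integral => x _ /=; congr (normc _)%:E.
rewrite (@bohr_lift_widen _ (size f)) ?size_poly// /bohr_lift.
apply: eq_bigr => m _.
by rewrite coef_twist /Phi bohr_monomial_rotate mulrA.
Qed.

Lemma exists_root_opp1 k : (0 < k)%N ->
  exists u : R[i], u ^+ k = -1 /\ normc u = 1.
Proof.
case: k => // k _.
have [u uk] :=
  @solve_monicpoly R[i] k.+1 (fun i => if i == 0%N then -1 else 0) isT.
have {}uk : u ^+ k.+1 = -1.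
  rewrite uk big_ord_recl/= expr0 mulr1 big1 ?addr0// => i _.
  by rewrite /= mul0r.
exists u; split=> //; have : normc u ^+ k.+1 = 1.
  by rewrite -normcX uk normcN normc1.
by move=> /eqP; rewrite pexpr_eq1// ?normc_ge0// => /eqP.
Qed.

(** A solution of [u ^+ k = -1] with [k] the distance between [a] and [b]. *)
Lemma exists_separating_unit a b : a != b ->
  exists u : R[i], u ^+ a = - u ^+ b /\ normc u = 1.
Proof.
wlog ab : a b / (a < b)%N.
  move=> sep; rewrite neq_ltn => /orP[ab|ba].
    by apply: sep => //; rewrite (ltn_eqF ab).
  have [|u [uE u1]] := sep _ _ ba; first by rewrite (ltn_eqF ba).
  by exists u; rewrite uE opprK.
move=> _; have [|u [uk u1]] := @exists_root_opp1 (b - a).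
  by rewrite subn_gt0.
exists u; split=> //.
by rewrite -[in RHS](subnK (ltnW ab)) exprD uk mulN1r opprK.
Qed.

(** Choose a prime where the exponents in [m0.+1] and [m1.+1] differ, and
    average [f] with its rotation in that variable, the angle being such that
    the two monomials are multiplied by opposite numbers. *)
Lemma kill_coefficient m0 m1 (f : {poly R[i]}) : m0 != m1 ->
  exists g : {poly R[i]}, [/\ g`_m0 = f`_m0, g`_m1 = 0,
    forall m, f`_m = 0 -> g`_m = 0 & A11_norm g <= A11_norm f].
Proof.
move=> m01.
have [j kj] : exists j, kappa m0.+1 j != kappa m1.+1 j.
  apply: contrapT => /forallNP eqk; move/eqP: m01; apply.
  apply: succn_inj; apply: eq_from_kappa => // j.
  by apply/eqP; apply: contrapT => /negP; exact: eqk.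
have [u [uE u1]] := exists_separating_unit kj.
set v := u ^+ kappa m0.+1 j.
have v1 : normc v = 1 by rewrite normcX u1 expr1n.
have vn0 : v != 0.
  by apply/eqP => v0; move/eqP: v1; rewrite v0 normc0 eq_sym oner_eq0.
exists (2^-1 *: (f + v^-1 *: twist j u f)).
have cE m : (2^-1 *: (f + v^-1 *: twist j u f))`_m =
    2^-1 * (f`_m + v^-1 * (f`_m * u ^+ kappa m.+1 j)).
  by rewrite coefZ coefD coefZ coef_twist.
split.
- by rewrite cE -/v mulrCA mulVf// mulr1; field.
- have uv : u ^+ kappa m1.+1 j = - v by rewrite /v uE opprK.
  by rewrite cE uv mulrN mulrN mulrCA mulVf// mulr1 subrr mulr0.
- by move=> m fm; rewrite cE fm mul0r !mulr0 addr0 mulr0.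
- rewrite A11_normZ normcV.
  rewrite normc2 mulrC ler_pdivrMr// mulr_natr mulr2n.
  apply: le_trans (A11_normD _ _) _; rewrite lerD2l.
  by rewrite A11_normZ normcV v1 invr1 mul1r A11_norm_twist.
Qed.

(** Coefficients removed earlier stay zero under later averages.  The third
    condition bounds the degree, so that finitely many averages suffice. *)
Lemma kill_coefficients m0 (f : {poly R[i]}) N :
  exists g : {poly R[i]}, [/\ g`_m0 = f`_m0,
    forall m, (m < N)%N -> m != m0 -> g`_m = 0,
    forall m, f`_m = 0 -> g`_m = 0 & A11_norm g <= A11_norm f].
Proof.
elim: N => [|N [g [g0 gN gf gn]]]; first by exists f; split.
have [NE|Nm0] := eqVneq N m0.
  exists g; split=> // m; rewrite ltnS leq_eqVlt => /predU1P[->|/gN//].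
  by rewrite NE eqxx.
have [|h [h0 hN hg hn]] := @kill_coefficient m0 N g; first by rewrite eq_sym.
exists h; split.
- by rewrite h0.
- move=> m; rewrite ltnS leq_eqVlt => /predU1P[->//|mN mm0].
  by apply: hg; exact: gN.
- by move=> m /gf/hg.
- exact: le_trans hn gn.
Qed.

(** Averaging away all other coefficients leaves a monomial. *)
Lemma A11_norm_monomial_le m (f : {poly R[i]}) :
  normc f`_m * A11_norm ('X^m : {poly R[i]}) <= A11_norm f.
Proof.
have [g [gm gN gf]] := kill_coefficients m f (size f); apply: le_trans.
rewrite -A11_normZ (_ : _ *: _ = g)//; apply/polyP => k.
rewrite coefZ coefXn; have [->|km] := eqVneq k m; first by rewrite mulr1 gm.
rewrite mulr0; have [kf|fk] := ltnP k (size f); first by rewrite gN.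
by rewrite gf// nth_default.
Qed.

End coefficient_bound.

(** * Norms of squarefree monomials *)

Section monomial_norm.
Context {R : realType}.
Local Notation RR := (measurableTypeR R).
Local Notation S := (seqspace (RR * RR)%type).
Local Notation mu := (@polydisk_measure R).
Import Normc.

(** Each coordinate lies almost surely in the disk. *)
Lemma polydisk_measureC : mu (~` polydisk) = 0%E.
Proof.
have mDc : measurable (~` @unit_disk R).
  by apply: measurableC; exact: measurable_unit_disk.
have mj j : measurable ((fun x : S => x j) @^-1` (~` @unit_disk R)).
  rewrite -[X in measurable X]setTI; apply: measurable_coordinate => //.
have -> : ~` polydisk = \bigcup_j ((fun x : S => x j) @^-1` (~` @unit_disk R)).
  rewrite -[RHS]setCK setC_bigcup; congr (~` _).
  apply/seteqP; split => x Dx j => [_ nD|]; first exact: nD (Dx j).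
  by apply: contrapT; exact: (Dx j I).
apply/eqP; rewrite -measure_le0.
apply: (@le_trans _ _
  (\sum_(j <oo) mu ((fun x : S => x j) @^-1` (~` @unit_disk R)))%E).
  by apply: measure_sigma_subadditive => //; exact: bigcup_measurable.
rewrite eseries0// => j _ _.
pose B i := if i == j then ~` @unit_disk R else setT.
have mB i : measurable (B i).
  by rewrite /B; case: ifP => // _; exact: mDc.
have -> : (fun x : S => x j) @^-1` (~` @unit_disk R) = rectangle j.+1 B.
  apply/seteqP; split => x /= Bx => [i _|].
    by rewrite /B; case: eqP => // ->.
  by have := Bx j (ltnSn j); rewrite /B eqxx.
rewrite /polydisk_measure infprodE// (bigD1 (Ordinal (ltnSn j)))//= /B eqxx.
rewrite disk_measureE; last exact: mDc.
have p0 : @planar_measure R set0 = 0%E by exact: measure0.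
by rewrite setICl p0 !mul0e.
Qed.

Lemma polydisk_measureI A : measurable A -> mu (A `&` polydisk) = mu A.
Proof.
move=> mA; have mD := @measurable_polydisk R.
rewrite -[X in _ = mu X](setIT A) -(setUv polydisk) setIUr.
rewrite measureU; last 3 first.
- exact: measurableI.
- by apply: measurableI => //; exact: measurableC.
- by rewrite setIACA setICr setI0.
rewrite [X in (_ + X)%E](_ : _ = 0%E) ?adde0//.
apply/eqP; rewrite -measure_le0 -polydisk_measureC.
apply: le_measure; rewrite ?inE.
- by apply: measurableI => //; exact: measurableC.
- exact: measurableC.
- exact: subIsetr.
Qed.

(** A lower approximation of [|z|] with [n] steps of height [1 / n]. *)
Definition radius_step (n : nat) (z : R * R) : R :=
  \sum_(i < n) n%:R^-1 * \1_(outer (i.+1%:R / n%:R)) z.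

(** The bounds by [r] and by [n] are proved together: when [n.+1 <= r], the step
    from [n] to [n.+1] follows from the bound by [n]. *)
Lemma sum_count_le (n : nat) (r : R) : 0 <= r ->
  \sum_(i < n) (i.+1%:R <= r)%R%:R <= r.
Proof.
move=> r0; suff [] : \sum_(i < n) (i.+1%:R <= r)%R%:R <= r /\
  \sum_(i < n) (i.+1%:R <= r)%R%:R <= n%:R :> R by [].
elim: n => [|n [ih1 ih2]]; first by rewrite big_ord0.
rewrite !big_ord_recr/=; case: (lerP n.+1%:R r) => rn; last first.
  by rewrite mulr0n addr0; split=> //; rewrite (le_trans ih2)// ler_nat.
have h : \sum_(i < n) (i.+1%:R <= r)%R%:R + 1%:R <= n.+1%:R :> R.
  by rewrite -[leRHS]natr1 lerD2r.
by split=> //; exact: le_trans h rn.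
Qed.

Lemma radius_step_le n z : (0 < n)%N -> radius_step n z <= normc (to_complex z).
Proof.
move=> n0; have n0' : 0 < n%:R :> R by rewrite ltr0n.
rewrite /radius_step -mulr_sumr mulrC ler_pdivrMr//.
apply: le_trans (@sum_count_le n _ _); last by rewrite mulr_ge0// normc_ge0.
apply: ler_sum => i _; rewrite indicE ler_nat.
have [zi|//] := boolP (z \in _); rewrite lt0b.
move: zi; rewrite inE /outer /= => zi.
rewrite -ler_pdivrMr// -(@ler_sqr _ _ (Num.sqrt _)) ?nnegrE ?sqrtr_ge0
  ?divr_ge0//.
by rewrite sqr_sqrtr// addr_ge0// sqr_ge0.
Qed.

Lemma radius_step_ge0 n z : 0 <= radius_step n z.
Proof. by apply: sumr_ge0 => i _; rewrite mulr_ge0// invr_ge0. Qed.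

(** The integral of [radius_step n] over the disk, as
    [disk_measure_outer] shows; it tends to [2 / 3]. *)
Definition radius_mean (n : nat) : R :=
  \sum_(i < n) n%:R^-1 * (1 - (i.+1%:R / n%:R) ^+ 2).

(** The modulus is bounded below by a step function, so that the integral of
    the product expands into measures of rectangles. *)
Lemma A11_norm_primorial_ge n k : (0 < n)%N ->
  radius_mean n ^+ k <= A11_norm ('X^((primorial k).-1) : {poly R[i]}).
Proof.
move=> n0; have mD := @measurable_polydisk R.
have intX := integrable_bohr_lift ('X^((primorial k).-1) : {poly R[i]}).
rewrite -lee_fin /A11_norm /Rintegral fineK; last exact: integrable_fin_num.
have n0' : 0 < n%:R :> R by rewrite ltr0n.
(* [tau j] is the step chosen in the [j]-th factor when the product of the step
   functions is expanded. *)
pose E (tau : {ffun 'I_k -> 'I_n}) (j : nat) : set (RR * RR) :=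
  if insub j is Some i then outer ((tau i).+1%:R / n%:R) else setT.
have mE tau j : measurable (E tau j).
  by rewrite /E; case: insubP => // i _ _; exact: measurable_outer.
have Eord tau (j : 'I_k) : E tau j = outer ((tau j).+1%:R / n%:R).
  by rewrite /E valK.
pose c : R := (n%:R^-1) ^+ k.
have prod_const (F : 'I_k -> R) :
    \prod_(j < k) (n%:R^-1 * F j) = c * \prod_(j < k) F j.
  by rewrite big_split /= prodr_const card_ord.
pose h (x : S) : \bar R := (\sum_(tau : {ffun 'I_k -> 'I_n})
  (c * \1_(rectangle k (E tau)) x)%:E)%E.
have mh tau : measurable_fun (polydisk : set S)
    (fun x => (c * \1_(rectangle k (E tau)) x)%:E).
  apply/measurable_EFinP/measurable_funTS/measurable_funM => //.
  by apply: measurable_indic; exact: measurable_rectangle.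
have c0 : 0 <= c by rewrite exprn_ge0// invr_ge0 ltW.
apply: (@le_trans _ _ (\int[mu]_(x in polydisk) h x)%E); last first.
  apply: ge0_le_integral => //.
  - by move=> x _; apply: sume_ge0 => tau _; rewrite lee_fin mulr_ge0.
  - exact: emeasurable_sum.
  - by case/integrableP : intX.
  move=> x _; rewrite /h sumEFin lee_fin bohr_liftXn prednK ?primorial_gt0//.
  have -> : \sum_tau c * \1_(rectangle k (E tau)) x =
      \prod_(j < k) radius_step n (x j).
    rewrite /radius_step bigA_distr_bigA; apply: eq_bigr => tau _.
    rewrite prod_const; congr (_ * _); rewrite indicE.
    have [xE|xE] := boolP (x \in _).
      rewrite big1// => j _; rewrite indicE mem_set//.
      by move: xE; rewrite inE => /(_ j (ltn_ord j)); rewrite Eord.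
    apply/esym/eqP/prodf_eq0; apply: contrapT => /forall2NP xE'.
    move/negP: xE; apply; rewrite inE => j jk.
    have := xE' (Ordinal jk); rewrite (Eord tau (Ordinal jk)) => -[//|].
    by move=> /negP; rewrite indicE pnatr_eq0 eqb0 negbK inE.
  rewrite /bohr_monomial normc_prod.
  apply: (@le_trans _ _ (\prod_(j < k) normc (to_complex (x j)))).
    apply: ler_prod => j _; rewrite radius_step_ge0/=; exact: radius_step_le.
  rewrite (big_ord_widen _ (fun j => normc (to_complex (x j)))
    (ltnW (ltn_primorial k))).
  rewrite big_mkcond /=; apply: ler_prod => j _.
  rewrite kappa_primorial normcX.
  case: ifP => _; last by rewrite expr0 ler01 lexx.
  by rewrite expr1 sqrtr_ge0 lexx.
rewrite ge0_integral_sum//; last first.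
  by move=> tau x _; rewrite lee_fin mulr_ge0.
under eq_bigr => tau _.
  under eq_integral do rewrite EFinM.
  rewrite ge0_integralZl//; last first.
    apply/measurable_EFinP/measurable_funTS.
    by apply: measurable_indic; exact: measurable_rectangle.
  rewrite integral_indic//; last exact: measurable_rectangle.
  rewrite [X in (_ * X)%E]polydisk_measureI; last exact: measurable_rectangle.
  rewrite [X in (_ * X)%E]infprodE//.
  over.
have disk_outer (i : 'I_n) : @disk_measure R (outer (i.+1%:R / n%:R)) =
    (1 - (i.+1%:R / n%:R) ^+ 2)%:E.
  rewrite disk_measure_outer// divr_gt0 ?ltr0n//= ler_pdivrMr// mul1r ler_nat.
  exact: ltn_ord.
have -> : radius_mean n ^+ k =
    \sum_(tau : {ffun 'I_k -> 'I_n})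
      c * \prod_(j < k) (1 - ((tau j).+1%:R / n%:R) ^+ 2).
  transitivity (\prod_(j < k) radius_mean n).
    by rewrite prodr_const card_ord.
  rewrite /radius_mean bigA_distr_bigA.
  by apply: eq_bigr => tau _; rewrite prod_const.
rewrite -sumEFin; apply: lee_sum => tau _.
rewrite EFinM -prodEFin (_ : (\prod_(j < k) disk_measure (E tau j))%E =
  (\prod_(j < k) (1 - ((tau j).+1%:R / n%:R) ^+ 2)%:E)%E)//.
by apply: eq_bigr => j _; rewrite Eord disk_outer.
Qed.

End monomial_norm.

(** * The symbol and the bound on its pairing *)

Section symbol.
Context {R : realType}.
Import Normc.

(** Any lower bound above [5 / 8], half of the ratio [5 / 4] of the symbol, makes
    the series in [A21_pairing_le] converge. *)
Lemma radius_mean20_ge : 16 / 25 <= @radius_mean R 20.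
Proof.
rewrite /radius_mean !big_ord_recr big_ord0 /=; lra.
Qed.

(** [25 / 16] is the inverse of the lower bound for the mean of [|z|]. *)
Lemma coefficient_primorial_le k (f : {poly R[i]}) :
  normc f`_((primorial k).-1) <= (25 / 16) ^+ k * A11_norm f.
Proof.
have c0 : 0 < (16 / 25) ^+ k :> R by rewrite exprn_gt0.
rewrite -(@ler_pM2l _ ((16 / 25) ^+ k))// mulrA -exprMn.
rewrite (_ : 16 / 25 * (25 / 16) = 1 :> R) ?expr1n ?mul1r; last by field.
apply: le_trans (A11_norm_monomial_le (primorial k).-1 f).
rewrite mulrC; apply: ler_wpM2l; first exact: normc_ge0.
apply: le_trans (@A11_norm_primorial_ge R 20 k isT).
have q0 : 0 <= 16 / 25 :> R by rewrite divr_ge0.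
have q20 := radius_mean20_ge.
by apply: lerXn2r; rewrite ?nnegrE//; exact: le_trans q0 q20.
Qed.

(** [(5 / 4)^k] at the [k]-th primorial and [0] elsewhere; since [k] is less
    than the [k]-th primorial, the sum over [k < n] misses nothing. *)
Definition symbol (n : nat) : R :=
  \sum_(k < n) (5 / 4) ^+ k *+ (primorial k == n).

Lemma symbol_ge0 n : 0 <= symbol n.
Proof. by apply: sumr_ge0 => k _; rewrite mulrn_wge0// exprn_ge0. Qed.

Lemma symbol_primorial m : symbol (primorial m) = (5 / 4) ^+ m.
Proof.
rewrite /symbol (bigD1 (Ordinal (ltn_primorial m)))//= eqxx mulr1n.
rewrite big1 ?addr0// => k; rewrite -val_eqE /= => km.
by rewrite (inj_eq primorial_inj) (negbTE km).
Qed.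

(** Summation over the support; it is an inequality because primorials beyond
    [N] occur only on the right. *)
Lemma sum_symbol_le (w : nat -> R) N : (forall n, 0 <= w n) ->
  \sum_(m < N) symbol m.+1 * w m.+1 <=
  \sum_(k < N) (5 / 4) ^+ k * w (primorial k).
Proof.
move=> w0.
have symbolE (m : 'I_N) :
    symbol m.+1 = \sum_(k < N) (5 / 4) ^+ k *+ (primorial k == m.+1).
  rewrite /symbol (big_ord_widen N
    (fun k => (5 / 4 : R) ^+ k *+ (primorial k == m.+1)))//.
  rewrite big_mkcond /=; apply: eq_bigr => k _.
  case: ifPn => //; rewrite -leqNgt => mk.
  by rewrite gtn_eqF// (leq_ltn_trans mk)// ltn_primorial.
under eq_bigr do rewrite symbolE mulr_suml.
rewrite exchange_big /=; apply: ler_sum => k _.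
have [kN|Nk] := ltnP (primorial k).-1 N.
  rewrite (bigD1 (Ordinal kN))//= prednK ?primorial_gt0// eqxx mulr1n.
  rewrite big1 ?addr0// => m; rewrite -val_eqE /= => mk.
  rewrite (_ : (primorial k == m.+1) = false) ?mulr0n ?mul0r//.
  by apply: contraNF mk => /eqP ->.
rewrite big1 ?mulr_ge0 ?exprn_ge0// => m _.
rewrite (_ : (primorial k == m.+1) = false) ?mulr0n ?mul0r//.
apply/negP => /eqP E; move: Nk; rewrite E /= leqNgt => /negP; apply.
exact: ltn_ord.
Qed.

Lemma sum_geometric_le (q : R) N : 0 <= q < 1 ->
  \sum_(k < N) q ^+ k <= (1 - q)^-1.
Proof.
move=> /andP[q0 q1]; have d0 : 0 < 1 - q by rewrite subr_gt0.
rewrite -[leRHS]mul1r ler_pdivlMr//.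
have := subrX1 q N; rewrite mulrC; set s := \sum_(k < N) _ => E.
by rewrite mulrC -opprB mulNr mulrC -E opprB gerBl exprn_ge0.
Qed.

Definition dirichlet_symbol (n : nat) : R[i] := (symbol n)%:C%C.

(** The [k]-th term is at most
    [(5 / 4)^k * (25 / 16)^k / 2^k = (125 / 128)^k] times the norm. *)
Lemma A21_pairing_le (f : {poly R[i]}) :
  normc (A21_pairing f dirichlet_symbol) <= 128 / 3 * A11_norm f.
Proof.
pose w n : R := normc f`_n.-1 / (numdiv n)%:R.
have w0 n : 0 <= w n by rewrite divr_ge0// normc_ge0.
apply: le_trans (le_normc_sum _ _ _) _.
apply: (@le_trans _ _ (\sum_(m < size f) symbol m.+1 * w m.+1)).
  apply: ler_sum => m _; rewrite !normcM normcV.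
  rewrite (_ : (dirichlet_symbol m.+1)^*%C = (symbol m.+1)%:C%C); last first.
    by rewrite /dirichlet_symbol /= oppr0.
  rewrite (_ : (numdiv m.+1)%:R = ((numdiv m.+1)%:R)%:C%C :> R[i]);
    last by rewrite rmorph_nat.
  rewrite !normc_real ger0_norm ?symbol_ge0// ger0_norm// /w /=.
  by rewrite -mulrA mulrCA lexx.
apply: le_trans (sum_symbol_le _ w0) _.
apply: (@le_trans _ _ (\sum_(k < size f) (125 / 128) ^+ k * A11_norm f)).
  apply: ler_sum => k _; rewrite /w.
  have -> : numdiv (primorial k) = (2 ^ k)%N.
    by rewrite -numdiv_primorialX expn1.
  rewrite natrX mulrA ler_pdivrMr ?exprn_gt0//.
  apply: (@le_trans _ _ ((5 / 4) ^+ k * ((25 / 16) ^+ k * A11_norm f))).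
    by apply: ler_wpM2l; [rewrite exprn_ge0|exact: coefficient_primorial_le].
  rewrite mulrA -exprMn [leRHS]mulrAC -exprMn.
  by rewrite (_ : 5 / 4 * (25 / 16) = 125 / 128 * 2 :> R)//; field.
rewrite -mulr_suml; apply: ler_wpM2r; first exact: A11_norm_ge0.
apply: le_trans (sum_geometric_le _ _) _; first by apply/andP; split; lra.
by rewrite (_ : 1 - 125 / 128 = 3 / 128 :> R) ?invf_div//; field.
Qed.

End symbol.

(** * Functionals on the completion and convergence of the symbol *)

Section dual_membership.
Context {R : realType}.
Import Normc.

Lemma real_cauchy_cvgn (u : nat -> R) :
  (forall e, 0 < e -> exists N, forall m n, (N <= m)%N -> (N <= n)%N ->
    `|u m - u n| < e) -> cvgn u.
Proof.
move=> uC; apply: cauchy_cvg; apply: cauchy_exP => e e0.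
have [N uN] := uC e e0; exists (u N); exists N => // n /= Nn.
by rewrite -ball_normE /=; exact: uN.
Qed.

Lemma A11_cauchy_norm_cvg (F : nat -> {poly R[i]}) :
  A11_cauchy F -> cvgn (fun n => A11_norm (F n)).
Proof.
move=> FC; apply: real_cauchy_cvgn => e e0; have [N FN] := FC e e0.
have tri (f g : {poly R[i]}) : A11_norm f - A11_norm g <= A11_norm (f - g).
  by rewrite lerBlDr; apply: le_trans (A11_normD _ _); rewrite subrK.
exists N => m n Nm Nn; rewrite ltr_norml ltrNl opprB.
by rewrite !(le_lt_trans (tri _ _))// FN.
Qed.

Section bounded_pairing.
Variables (b : nat -> R[i]) (K : R).
Hypothesis bK : forall f, normc (A21_pairing f b) <= K * A11_norm f.

Lemma A21_pairing_widen N (f : {poly R[i]}) : (size f <= N)%N ->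
  A21_pairing f b =
  \sum_(m < N) f`_m * (b m.+1)^*%C / (numdiv m.+1)%:R.
Proof.
move=> fN; rewrite /A21_pairing.
rewrite (big_ord_widen N (fun m => f`_m * (b m.+1)^*%C / (numdiv m.+1)%:R) fN).
rewrite big_mkcond /=; apply: eq_bigr => m _; case: ltnP => // fm.
by rewrite nth_default ?mul0r.
Qed.

Lemma A21_pairing_linear c (f g : {poly R[i]}) :
  A21_pairing (c *: f + g) b = c * A21_pairing f b + A21_pairing g b.
Proof.
pose N := maxn (size f) (size g).
have sN : (size (c *: f + g)%R <= N)%N.
  rewrite (leq_trans (size_polyD _ _))// geq_max leq_maxr andbT.
  by rewrite (leq_trans (size_scale_leq _ _))// leq_maxl.
rewrite !(@A21_pairing_widen N) ?leq_maxl ?leq_maxr// mulr_sumr -big_split.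
by apply: eq_bigr => m _; rewrite coefD coefZ !mulrDl !mulrA.
Qed.

Let re F (n : nat) : R := complex.Re (A21_pairing (F n : {poly R[i]}) b).
Let im F (n : nat) : R := complex.Im (A21_pairing (F n : {poly R[i]}) b).

(* The constant is made positive, so that one can divide by it. *)
Let bK1 f : normc (A21_pairing f b) <= (`|K| + 1) * A11_norm f.
Proof.
apply: le_trans (bK f) _; apply: ler_wpM2r; first exact: A11_norm_ge0.
by rewrite (le_trans (ler_norm K))// lerDl.
Qed.

Let pairing_cauchy F : A11_cauchy F -> forall e, 0 < e -> exists N, forall m n,
  (N <= m)%N -> (N <= n)%N ->
  normc (A21_pairing (F m) b - A21_pairing (F n) b) < e.
Proof.
move=> FC e e0; have K0 : 0 < `|K| + 1 by rewrite ltr_wpDl.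
have [N FN] := FC (e / (`|K| + 1)) (divr_gt0 e0 K0).
exists N => m n Nm Nn.
have -> : A21_pairing (F m) b - A21_pairing (F n) b = A21_pairing (F m - F n) b.
  by rewrite [F m - F n]addrC -(scaleN1r (F n)) A21_pairing_linear mulN1r addrC.
by rewrite (le_lt_trans (bK1 _))// mulrC -ltr_pdivlMr// FN.
Qed.

Let re_cvg F : A11_cauchy F -> cvgn (re F).
Proof.
move=> FC; apply: real_cauchy_cvgn => e e0.
have [N FN] := pairing_cauchy FC e0; exists N => m n Nm Nn.
by rewrite /re -raddfB (le_lt_trans (normr_Re _))// FN.
Qed.

Let im_cvg F : A11_cauchy F -> cvgn (im F).
Proof.
move=> FC; apply: real_cauchy_cvgn => e e0.
have [N FN] := pairing_cauchy FC e0; exists N => m n Nm Nn.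
by rewrite /im -raddfB (le_lt_trans (normr_Im _))// FN.
Qed.

(** A pairing bounded in the norm of [A^1_1] extends to the completion by
    taking limits along Cauchy sequences. *)
Lemma bounded_pairing_extends : exists L, A11_bounded_functional L /\
  forall f : {poly R[i]}, L (fun=> f) = A21_pairing f b.
Proof.
exists (fun F => (limn (re F) +i* limn (im F))%C); split; last first.
  move=> f; rewrite /re /im !lim_cst//.
  by case: (A21_pairing f b).
split=> [c F G FC GC|].
  case: c => x y.
  have E1 : limn (re (fun n => (x +i* y)%C *: F n + G n)) =
      x * limn (re F) - y * limn (im F) + limn (re G).
    apply: cvg_lim => //.
    rewrite (_ : re _ = fun n => x * re F n - y * im F n + re G n); last first.
      apply/funext => n; rewrite /re /im A21_pairing_linear.
      by case: (A21_pairing (F n) b) (A21_pairing (G n) b) => ? ? [].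
    apply: cvgD; last exact: re_cvg.
    by apply: cvgB; apply: cvgM;
      [exact: cvg_cst|exact: re_cvg|exact: cvg_cst|exact: im_cvg].
  have E2 : limn (im (fun n => (x +i* y)%C *: F n + G n)) =
      x * limn (im F) + y * limn (re F) + limn (im G).
    apply: cvg_lim => //.
    rewrite (_ : im _ = fun n => x * im F n + y * re F n + im G n); last first.
      apply/funext => n; rewrite /re /im A21_pairing_linear.
      by case: (A21_pairing (F n) b) (A21_pairing (G n) b) => ? ? [].
    apply: cvgD; last exact: im_cvg.
    by apply: cvgD; apply: cvgM;
      [exact: cvg_cst|exact: im_cvg|exact: cvg_cst|exact: re_cvg].
  by rewrite E1 E2; simpc.
exists ((`|K| + 1) *+ 2) => F FC.
have nF := A11_cauchy_norm_cvg FC.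
have lim_le (u : nat -> R) : cvgn u ->
    (forall n, `|u n| <= (`|K| + 1) * A11_norm (F n)) ->
    `|limn u| <= (`|K| + 1) * A11_completion_norm F.
  move=> cu uF.
  have cu' : `|u n| @[n --> \oo] --> `|limn u| by apply: cvg_norm; exact: cu.
  have cF : (`|K| + 1) * A11_norm (F n) @[n --> \oo] -->
      (`|K| + 1) * A11_completion_norm F.
    by apply: cvgM; [exact: cvg_cst|exact: nF].
  by apply: ler_cvg_to cu' cF _; exact: nearW.
apply: le_trans (normc_le_ReIm _) _ => /=.
rewrite mulrnAl mulr2n; apply: lerD.
  apply: lim_le (re_cvg FC) _ => n.
  by apply: le_trans (normr_Re _) (bK1 _).
apply: lim_le (im_cvg FC) _ => n.
by apply: le_trans (normr_Im _) (bK1 _).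
Qed.

End bounded_pairing.

(** For [Re s > 1] the absolute values sum to at most [\sum_k (5 / 4)^k / N_k],
    and the [k]-th primorial [N_k] is at least [2^k]. *)
Lemma dirichlet_symbol_cvg (s : R[i]) : 1 < complex.Re s ->
  dirichlet_series_cvg dirichlet_symbol s.
Proof.
move=> s1.
pose w (n : nat) : R := n%:R^-1.
pose t n : R := normc (dirichlet_term dirichlet_symbol s n).
have t0 n : 0 <= t n by exact: normc_ge0.
have t_le n : t n.+1 <= symbol n.+1 * w n.+1.
  rewrite /t /dirichlet_term /dirichlet_symbol !normcM !normc_real.
  rewrite ger0_norm ?symbol_ge0// ger0_norm ?powR_ge0//.
  set c := cos _; set d := sin _.
  have -> : normc (c -i* d)%C = 1 by rewrite /= sqrrN cos2Dsin2 sqrtr1.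
  rewrite mulr1; apply: ler_wpM2l; first exact: symbol_ge0.
  rewrite /w -powR_inv1// ler_powR// ?ler1n// lerN2; exact: ltW.
have t_sum N : \sum_(1 <= n < N) t n <= 8 / 3.
  case: N => [|N]; first by rewrite big_geq.
  rewrite big_add1 /= big_mkord.
  apply: (@le_trans _ _ (\sum_(m < N) symbol m.+1 * w m.+1)).
    by apply: ler_sum => m _; exact: t_le.
  apply: le_trans (sum_symbol_le _ _) _; first by move=> n; rewrite invr_ge0.
  apply: (@le_trans _ _ (\sum_(k < N) (5 / 8) ^+ k)).
    apply: ler_sum => k _; rewrite /w ler_pdivrMr ?ltr0n ?primorial_gt0//.
    apply: (@le_trans _ _ ((5 / 8) ^+ k * (2 ^ k)%:R)).
      by rewrite natrX -exprMn (_ : 5 / 8 * 2 = 5 / 4 :> R)//; field.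
    by apply: ler_wpM2l; [rewrite exprn_ge0|rewrite ler_nat leq_exp2_primorial].
  apply: le_trans (sum_geometric_le _ _) _; first by apply/andP; split; lra.
  by rewrite (_ : 1 - 5 / 8 = 3 / 8 :> R) ?invf_div//; field.
have abs_cvg (u : nat -> R) : (forall n, `|u n| <= t n) ->
    cvgn (fun N => \sum_(1 <= n < N) u n).
  move=> ut; pose v n : R := if n == 0%N then 0 else u n.
  have vE (F : nat -> R) N : F 0%N = 0 ->
      \sum_(0 <= n < N) F n = \sum_(1 <= n < N) F n.
    move=> F0; case: N => [|N]; first by rewrite !big_geq.
    by rewrite big_ltn// F0 add0r.
  have -> : (fun N => \sum_(1 <= n < N) u n) = series v.
    apply/funext => N; rewrite /series/= vE//.
    by apply: eq_big_nat => -[].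
  apply: normed_cvg; apply: nondecreasing_is_cvgn.
    apply/nondecreasing_seqP => N.
    change (\sum_(0 <= k < N) `|v k| <= \sum_(0 <= k < N.+1) `|v k|).
    rewrite big_nat_recr//= lerDl.
    exact: normr_ge0.
  exists (8 / 3) => _ [N _ <-]; apply: le_trans (t_sum N).
  change (\sum_(0 <= k < N) `|v k| <= \sum_(1 <= n < N) t n).
  rewrite vE ?normr0//; apply: ler_sum_nat => -[//|n] _; exact: ut.
split; apply: abs_cvg => n; [exact: normr_Re|exact: normr_Im].
Qed.

Lemma dirichlet_symbol_A11_dual : @A11_dual R dirichlet_symbol.
Proof.
split; first by exists 1; exact: dirichlet_symbol_cvg.
exact: bounded_pairing_extends A21_pairing_le.
Qed.

End dual_membership.

(** * Unboundedness of the Volterra operator *)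

Section volterra_unbounded.
Context {R : realType}.
Import Normc.
Local Notation delta n := (fun k : nat => (k == n)%:R : R[i]).

Lemma A21_sqnorm_delta n : (0 < n)%N ->
  A21_sqnorm (delta n) = ((numdiv n)%:R^-1)%:E.
Proof.
move=> n0; rewrite /A21_sqnorm.
apply: cvg_lim => //; apply: cvg_near_cst; exists n.+1 => // N /= nN.
rewrite (bigD1_seq n) ?mem_index_iota ?iota_uniq ?n0//=.
rewrite eqxx normc1 expr1n div1r big1 ?adde0// => k kn.
by rewrite (negbTE kn) normc0 expr0n mul0r.
Qed.

(** Among the divisors of [n ^ 2] only [n] contributes, with the factor
    [ln n / ln (n ^ 2) = 1 / 2]. *)
Lemma volterra_delta (b : nat -> R[i]) n : (1 < n)%N ->
  volterra b (delta n) (n ^ 2) = 2^-1 * b n.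
Proof.
move=> n1; have n0 : (0 < n)%N by exact: ltnW.
have n20 : (0 < n ^ 2)%N by rewrite expn_gt0 n0.
have ln0 : ln n%:R != 0 :> R by rewrite gt_eqF// ln_gt0// ltr1n.
rewrite /volterra -big_filter (bigD1_seq n)/=; last 2 first.
- rewrite mem_filter -dvdn_divisors// dvdn_exp// andbT.
  by rewrite -[X in (X < _)%N]expn1 ltn_exp2l.
- exact/filter_uniq/divisors_uniq.
rewrite big1 => [|k kn]; last by rewrite (negbTE kn) !mul0r.
rewrite eqxx mul1r addr0 expnS expn1 mulnK// natrM lnM ?posrE ?ltr0n//.
have lc0 : (ln n%:R : R)%:C%C != 0 by rewrite fmorph_eq0.
rewrite fmorphV rmorphD /=; field.
by rewrite -mulr2n mulrn_eq0.
Qed.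

(** The norm is bounded below by the term at the square of the primorial, which
    has [3 ^ m.+1] divisors. *)
Lemma volterra_symbol_lower m :
  (((25 / 16) ^+ m.+1 / 4 / (3 ^+ m.+1))%:E <=
  A21_sqnorm (volterra (@dirichlet_symbol R) (delta (primorial m.+1))))%E.
Proof.
set n := primorial m.+1.
have n1 : (1 < n)%N by rewrite (leq_ltn_trans _ (ltn_primorial _)).
have n20 : (0 < n ^ 2)%N by rewrite expn_gt0 (ltnW n1).
set v := volterra _ _.
apply: le_trans (nneseries_lim_ge (n ^ 2).+1 _); last first.
  by move=> k _ _; rewrite lee_fin divr_ge0// exprn_ge0// normc_ge0.
rewrite (bigD1_seq (n ^ 2)%N) ?mem_index_iota ?iota_uniq ?n20 ?leqnn//=.
apply: (@le_trans _ _
  (normc (v (n ^ 2)%N) ^+ 2 / (numdiv (n ^ 2))%:R)%:E); last first.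
  rewrite leeDl// sume_ge0// => k _.
  by rewrite lee_fin divr_ge0// exprn_ge0// normc_ge0.
rewrite lee_fin /v volterra_delta// numdiv_primorialX natrX normcM normcV.
rewrite /dirichlet_symbol symbol_primorial normc_real ger0_norm ?exprn_ge0//.
rewrite normc2.
apply: ler_wpM2r; first by rewrite invr_ge0 exprn_ge0.
rewrite [leRHS]exprMn -exprM mulnC exprM.
rewrite (_ : (5 / 4) ^+ 2 = 25 / 16 :> R); last by field.
by rewrite mulrC exprVn -natrX.
Qed.

Lemma bernoulli (x : R) m : 0 <= x -> 1 + m%:R * x <= (1 + x) ^+ m.
Proof.
move=> x0; elim: m => [|m ih]; first by rewrite mul0r addr0 expr0.
rewrite exprS; apply: (@le_trans _ _ ((1 + x) * (1 + m%:R * x))).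
  rewrite -natr1; have : 0 <= x * (m%:R * x) by rewrite !mulr_ge0.
  nra.
by apply: ler_wpM2l => //; rewrite addr_ge0.
Qed.

(** Comparing with [A21_sqnorm_delta], a bound [K] for the operator would give
    [(25 / 24) ^+ m.+1 <= 4 * K ^+ 2] for all [m]. *)
Lemma dirichlet_symbol_volterra_unbounded :
  ~ volterra_bounded (@dirichlet_symbol R).
Proof.
move=> [K TK].
have bound m : (25 / 24) ^+ m.+1 <= 4 * K ^+ 2.
  set f := delta (primorial m.+1).
  have sf : A21_sqnorm f = ((2 ^+ m.+1)^-1)%:E.
    rewrite A21_sqnorm_delta ?primorial_gt0//.
    by rewrite -[primorial _]expn1 numdiv_primorialX natrX.
  have [|] := TK f; first by rewrite /A21 /= sf ltry.
  rewrite /A21 /A21_norm /= sf /= => vfin.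
  have := volterra_symbol_lower m; rewrite -/f.
  have v0 : (0 <= A21_sqnorm (volterra dirichlet_symbol f))%E.
    apply: nneseries_ge0 => k _ _.
    by rewrite lee_fin divr_ge0// exprn_ge0// normc_ge0.
  rewrite -(@fineK _ (A21_sqnorm (volterra _ _))) ?ge0_fin_numE//.
  have : 0 <= fine (A21_sqnorm (volterra dirichlet_symbol f)).
    exact: fine_ge0.
  move: (fine _) => V V0; rewrite lee_fin => lowV.
  set d : R := (2 ^+ m.+1)^-1 => VK.
  have d0 : 0 <= d by rewrite invr_ge0 exprn_ge0.
  have {}VK : V <= K ^+ 2 * d.
    rewrite -[V]sqr_sqrtr// -[d]sqr_sqrtr// -exprMn.
    rewrite ler_sqr ?nnegrE ?sqrtr_ge0//.
    by rewrite (le_trans _ VK)// sqrtr_ge0.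
  have {lowV}VK := le_trans lowV VK.
  have e2 : 2 ^+ m.+1 = d^-1 :> R by rewrite invrK.
  have -> : 25 / 24 = 25 / 16 / 3 * 2 :> R by field.
  rewrite !exprMn exprVn e2 ler_pdivrMr ?invr_gt0 ?exprn_gt0//.
  rewrite mulrAC ler_pdivrMr// -mulrA mulrC in VK.
  rewrite -expr_div_n exprVn mulrC; apply: le_trans VK _.
  by rewrite (_ : 4 * K ^+ 2 * d = K ^+ 2 * (d * 4))//; ring.
(* The right-hand side is the bound of [bernoulli] for [1 + 1 / 24]. *)
have [N NK] : exists N, 4 * K ^+ 2 < 1 + N.+1%:R * (1 / 24) :> R.
  exists (Num.truncn (96 * K ^+ 2)).
  have K0 : 0 <= 96 * K ^+ 2 by rewrite mulr_ge0// sqr_ge0.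
  have /andP[_] := truncn_itv K0; lra.
have := @bernoulli (1 / 24) N.+1.
rewrite (_ : 1 + 1 / 24 = 25 / 24 :> R); last by field.
have x0 : 0 <= 1 / 24 :> R by rewrite divr_ge0.
move=> /(_ x0) bN.
by have := lt_le_trans NK (le_trans bN (bound N)); rewrite ltxx.
Qed.

End volterra_unbounded.

Theorem proposition10 (R : realType) :
  ~ (@A11_dual R `<=` @volterra_symbols R) /\
  exists g : nat -> R[i], A11_dual g /\ ~ volterra_bounded g.
Proof.
have dual := @dirichlet_symbol_A11_dual R.
have unbounded := @dirichlet_symbol_volterra_unbounded R.
split; first by move=> /(_ _ dual)[].
by exists dirichlet_symbol.
Qed.
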